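(* For every fixed integer $m\ge 2$, the decision problem Fractional Partition (FP) with $m$ parts can be solved in pseudo-polynomial time.
   Context: Fractional Partition (FP) with $m$ parts. Instance: two finite lists of positive integers (repetitions allowed) $A=(a_1,\dots,a_n)$ and $B=(b_1,\dots,b_n)$ of the same length $n\ge 1$. Put $I=\{1,2,\dots,n\}$, $S=\sum_{i\in I}a_i$, $T=\sum_{i\in I}b_i$. For a partition of $I$ into $m$ pairwise disjoint subsets $I_1,\dots,I_m$ with union $I$, let $$r_j=\frac{\sum_{i\in I_j}a_i}{\sum_{i\in I_j}b_i},\qquad j=1,\dots,m,$$ where by convention a fraction with denominator $0$ has value $0$ (so $r_j=0$ if $I_j=\emptyset$). Question: does there exist a partition of $I$ into $m$ disjoint subsets $I_1,\dots,I_m$ such that $r_j=S/T$ for all $j=1,\dots,m$? Here $m$ is fixed and is not part of the input. A problem is solvable in pseudo-polynomial time if there is an algorithm that correctly solves every instance in time bounded by a polynomial in the length of the instance and the largest integer occurring in it. *)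

(* Defs.v *)
From mathcomp Require Import all_boot all_order all_algebra.
Set Implicit Arguments.
Unset Strict Implicit.
Unset Printing Implicit Defensive.
Import GRing.Theory.

(* The model of computation is the random access machine of Cook and Reckhow,
   with registers X_0, X_1, ... holding natural numbers, truncated subtraction
   and no multiplication, under the logarithmic cost criterion.  It simulates
   and is simulated by multitape Turing machines with polynomial overhead.
   The input is a finite list of numbers, consumed from left to right.       *)

Definition bitlen (x : nat) : nat := (trunc_log 2 x).+1.

Inductive instr : Type :=
| Const of nat & nat        (* Const i c   : X_i <- c                        *)
| Add of nat & nat & nat    (* Add i j k   : X_i <- X_j + X_k                *)
| Sub of nat & nat & nat    (* Sub i j k   : X_i <- X_j - X_k (truncated)    *)
| Fetch of nat & nat        (* Fetch i j   : X_i <- X_(X_j)                  *)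
| Store of nat & nat        (* Store i j   : X_(X_i) <- X_j                  *)
| Jpos of nat & nat         (* Jpos j l    : go to l if X_j > 0              *)
| Read of nat               (* Read i      : X_i <- next input, 0 if none    *)
| Halt of bool.             (* Halt b      : stop with answer b              *)

Definition program := seq instr.

Record config : Type := Config {
  pc : nat;
  reg : nat -> nat;
  inp : seq nat
}.

Definition init (input : seq nat) : config := Config 0 (fun=> 0) input.

Definition upd (X : nat -> nat) (i v : nat) : nat -> nat :=
  fun k => if k == i then v else X k.

Definition step (ins : instr) (c : config) : option config :=
  let: Config p X s := c in
  match ins with
  | Const i v => Some (Config p.+1 (upd X i v) s)
  | Add i j k => Some (Config p.+1 (upd X i (X j + X k)) s)
  | Sub i j k => Some (Config p.+1 (upd X i (X j - X k)) s)
  | Fetch i j => Some (Config p.+1 (upd X i (X (X j))) s)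
  | Store i j => Some (Config p.+1 (upd X (X i) (X j)) s)
  | Jpos j l => Some (Config (if 0 < X j then l else p.+1) X s)
  | Read i => Some (Config p.+1 (upd X i (head 0 s)) (behead s))
  | Halt _ => None
  end.

Definition cost (ins : instr) (c : config) : nat :=
  let: Config _ X s := c in
  match ins with
  | Const _ v => bitlen v
  | Add _ j k | Sub _ j k => bitlen (X j) + bitlen (X k)
  | Fetch _ j => bitlen (X j) + bitlen (X (X j))
  | Store i j => bitlen (X i) + bitlen (X j)
  | Jpos j _ => bitlen (X j)
  | Read _ => bitlen (head 0 s)
  | Halt _ => 1
  end.

(* [halts P c t b]: the (unique) computation of P from c stops with answer b,
   at total cost t.  A jump outside of P blocks the computation: no answer.  *)
Inductive halts (P : program) : config -> nat -> bool -> Prop :=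
| halts_now c b :
    onth P (pc c) = Some (Halt b) -> halts P c (cost (Halt b) c) b
| halts_later c ins c' t b :
    onth P (pc c) = Some ins -> step ins c = Some c' ->
    halts P c' t b -> halts P c (cost ins c + t) b.

Lemma halts_det P c t b t' b' :
  halts P c t b -> halts P c t' b' -> t = t' /\ b = b'.
Proof.
move=> H; elim: H t' b' => {c t b} [c b Pc | c ins c' t b Pc st _ IH] t' b' H.
  case: H Pc => {c t' b'} [c b' -> [->] // | c ins c' t' b' -> st _ [ins_eq]].
  by rewrite ins_eq in st; case: c st.
case: H Pc st => {c t' b'} [c b' -> [<-] | c ins' c2 t' b' -> st' H' [<-]].
  by case: c.
by rewrite st' => -[eq_c]; rewrite eq_c in H'; have [-> ->] := IH _ _ H'.
Qed.

(* A bound "polynomial in the length and the largest integer" is the value of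
   a bivariate polynomial with coefficients in nat.                          *)
Definition pseudo_polynomial_time (inst : Type) (encode : inst -> seq nat)
    (largest : inst -> nat) (yes : inst -> Prop) : Prop :=
  exists (P : program) (p : {poly {poly nat}}), forall x : inst,
    exists (t : nat) (b : bool),
      [/\ halts P (init (encode x)) t b,
          b = true <-> yes x
        & t <= p.[(\sum_(v <- encode x) bitlen v)%N, largest x]%R].

Record fp_instance : Type := FPInstance {
  fp_n : nat;
  fp_a : fp_n.-tuple nat;
  fp_b : fp_n.-tuple nat;
  fp_n_gt0 : 0 < fp_n;
  fp_a_gt0 : all (leq 1) fp_a;
  fp_b_gt0 : all (leq 1) fp_b
}.

Definition fp_encode (x : fp_instance) : seq nat :=
  fp_n x :: fp_a x ++ fp_b x.

Definition fp_largest (x : fp_instance) : nat :=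
  \max_(v <- fp_a x ++ fp_b x) v.

(* In rat, q / 0 = 0, which is the convention for the parts with empty sum.  *)
Definition fp_ratio (x : fp_instance) (J : {set 'I_(fp_n x)}) : rat :=
  ((\sum_(i in J) tnth (fp_a x) i)%N%:R /
   (\sum_(i in J) tnth (fp_b x) i)%N%:R)%R.

(* The parts are labelled by 'I_m and are allowed to be empty.               *)
Definition is_labelled_partition (n m : nat) (J : 'I_m -> {set 'I_n}) : Prop :=
  (forall j k, j != k -> [disjoint J j & J k]) /\ \bigcup_j J j = [set: 'I_n].

Definition fp_yes (m : nat) (x : fp_instance) : Prop :=
  exists J : 'I_m -> {set 'I_(fp_n x)},
    is_labelled_partition J /\
    forall j, fp_ratio (J j) =
      ((\sum_i tnth (fp_a x) i)%N%:R / (\sum_i tnth (fp_b x) i)%N%:R)%R.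

(* Main.v *)
Require Import Defs.
From mathcomp Require Import all_boot all_order all_algebra.
From mathcomp Require Import zify.
Set Implicit Arguments.
Unset Strict Implicit.
Unset Printing Implicit Defensive.

(** Let [S] and [T] be the totals of the [a_i] and of the [b_i], and [K = S * T].
    A part [J] with sums [A] and [B] has the ratio [S / T] iff it is nonempty and
    [T * A = S * B].  Give item [i] the weight [u_i = T * a_i + S * (T - b_i)],
    that is [T * a_i - S * b_i + K].  Then [J] weighs [T * A - S * B + K * #|J|],
    and since [T * A] and [S * B] lie between 1 and [K] for nonempty [J], the part
    is good iff its weight is a positive multiple of [K] ([weight_multiple]).
    When all the parts are good, these multiples add up to [n].  So a partition
    exists iff the [n] items can be placed in [m] parts in such a way that
    [n - m] chips of weight [K] can then be removed, leaving the weight [K] in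
    each part ([fp_yesE]).  The chips enforce that no part is empty.

    Write the weights of the [m] parts as the digits of one number in radix
    [Q = 1 + 2 * n * K], which exceeds every weight that occurs.  Placing an item
    in part [j] adds [u_i * Q ^ j] to this code, removing a chip subtracts
    [K * Q ^ j], and the question is whether the code with all digits [K] is
    reached ([solver_answerE]).  There are [Q ^ m] codes, a polynomial number for
    fixed [m], so the sets of reachable codes fit into tables: one table per item
    and per chip, each computed from the previous one ([wp_layer]).

    The algorithm is written in a small structured language whose compiler to the
    random access machine is proved correct once ([exec_com]).  Its weakest
    preconditions require that no computed number exceeds a bound [W].  The
    running time then needs no analysis of its own: each loop makes at most [W]
    iterations, so the time is at most a polynomial in [W] read off the program
    ([duration], [decider_halts]), and [W] is polynomial in the length of the
    instance and its largest number ([poly_bounded_value]). *)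

Local Arguments onth : simpl never.

(** * Runs of the machine with bounded step costs *)

(** The index [k] is an upper bound on the number of steps, not their exact
    number: appending an empty run then increases the bound. *)
Inductive runs (P : program) (u : nat) : nat -> config -> config -> Prop :=
| runs_refl k c : runs P u k c c
| runs_step k c ins c' c'' :
    onth P (pc c) = Some ins -> step ins c = Some c' -> cost ins c <= u ->
    runs P u k c' c'' -> runs P u k.+1 c c''.

Lemma runs_at P u k L X tp ins c' c'' :
  onth P L = Some ins -> step ins (Config L X tp) = Some c' ->
  cost ins (Config L X tp) <= u ->
  runs P u k c' c'' -> runs P u k.+1 (Config L X tp) c''.
Proof. exact: (@runs_step P u k (Config L X tp)). Qed.

Lemma runs_trans P u k l c c' c'' :
  runs P u k c c' -> runs P u l c' c'' -> runs P u (k + l) c c''.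
Proof.
move=> H; elim: H l c'' => {k c c'} [k c | k c ins c' c2 Pc st le_u _ IH] l c'' H.
  elim: H k => {l c c''} [l c | l c ins c' c'' Pc st le_u _ IH] k.
    exact: runs_refl.
  by rewrite addnS; apply: runs_step Pc st le_u _.
by rewrite addSn; apply: runs_step Pc st le_u (IH _ _ H).
Qed.

Lemma runs_le P u k l c c' : k <= l -> runs P u k c c' -> runs P u l c c'.
Proof.
by move=> /subnKC <- H; apply: runs_trans H (runs_refl _ _ _ _).
Qed.

Lemma runs_halts P u k c c' b :
  runs P u k c c' -> onth P (pc c') = Some (Halt b) ->
  exists2 t, halts P c t b & t <= k * u + 1.
Proof.
elim=> {k c c'} [k c | k c ins c' c2 Pc st le_u _ IH] Pc'.
  exists 1; last by rewrite addn1.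
  by have := halts_now Pc'; case: c {Pc'}.
have [t Ht le_t] := IH Pc'.
exists (cost ins c + t); first exact: halts_later Pc st Ht.
by rewrite mulSn -addnA leq_add.
Qed.

Fixpoint code_at (P : program) (L : nat) (code : program) : Prop :=
  if code is ins :: code' then onth P L = Some ins /\ code_at P L.+1 code'
  else True.

Lemma code_at_cat P L c1 c2 :
  code_at P L (c1 ++ c2) <-> code_at P L c1 /\ code_at P (L + size c1) c2.
Proof.
elim: c1 L => [|i c1 IH] L /=; first by rewrite addn0; tauto.
by rewrite IH addSnnS; tauto.
Qed.

Lemma code_at_suffix P c : code_at (P ++ c) (size P) c.
Proof.
elim: c P => //= i c IH P; split; first by rewrite onth_cat ltnn subnn.
by rewrite -cat_rcons -(size_rcons P i).
Qed.

Lemma bitlen_le x : bitlen x <= x.+1.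
Proof.
rewrite /bitlen ltnS; case: x => // x.
by have /andP[/(leq_trans (ltn_expl _ _)) /ltnW-> //] :=
  @trunc_log_bounds 2 x.+1 isT isT.
Qed.

(** Charging the values themselves instead of their bit lengths is an exponential
    overestimate, but one that a pseudo-polynomial bound can afford; it keeps
    logarithms out of the analysis.  Each instruction reads at most two numbers. *)
Definition unit_cost (W : nat) := 2 * W.+1.

Lemma bitlen1_cost W x : x <= W -> bitlen x <= unit_cost W.
Proof. by move=> le_xW; have := bitlen_le x; rewrite /unit_cost; lia. Qed.

Lemma bitlen2_cost W x y :
  x <= W -> y <= W -> bitlen x + bitlen y <= unit_cost W.
Proof.
move=> le_xW le_yW; have := bitlen_le x; have := bitlen_le y.
rewrite /unit_cost; lia.
Qed.

Lemma upd_eq X i v : upd X i v i = v.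
Proof. by rewrite /upd eqxx. Qed.

Lemma upd_neq X i v k : k != i -> upd X i v k = X k.
Proof. by rewrite /upd => /negbTE ->. Qed.

(** * A structured language and its weakest preconditions *)

Inductive expr :=
| Lit of nat
| Var of nat
| Plus of expr & expr
| Minus of expr & expr
| Cell of expr.

Inductive com :=
| Assign of nat & expr
| Write of expr & expr
| Input of nat
| Seq of com & com
| Repeat of nat & com.

Record state := State { vars : seq nat; heap : nat -> nat; tape : seq nat }.

Definition getv (s : state) (i : nat) := nth 0 (vars s) i.
Definition setv (s : state) (i v : nat) :=
  State (set_nth 0 (vars s) i v) (heap s) (tape s).
Definition setm (s : state) (a v : nat) :=
  State (vars s) (upd (heap s) a v) (tape s).

Fixpoint eval (s : state) (e : expr) : nat :=
  match e with
  | Lit v => v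
  | Var i => getv s i
  | Plus e1 e2 => eval s e1 + eval s e2
  | Minus e1 e2 => eval s e1 - eval s e2
  | Cell e => heap s (eval s e)
  end.

(** No number above [W] may be computed on the way to the value of [e].  Only
    literals and sums are restricted, because the other constructs return
    numbers that are already bounded. *)
Fixpoint safe (W : nat) (s : state) (e : expr) : Prop :=
  match e with
  | Lit v => v <= W
  | Var _ => True
  | Plus e1 e2 => [/\ safe W s e1, safe W s e2 & eval s e1 + eval s e2 <= W]
  | Minus e1 e2 => safe W s e1 /\ safe W s e2
  | Cell e => safe W s e
  end.

(** [Repeat i c] runs [c] and then decrements variable [i], as long as [i] is
    positive.  Since [c] must leave [i] unchanged, the number of iterations is
    the value of [i] at entry; the invariant [I] is indexed by the number of
    iterations that remain.  Besides correctness, the precondition asserts that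
    all computed numbers are at most [W]: this is what yields time bounds. *)
Fixpoint wp (W : nat) (c : com) (Q : state -> Prop) (s : state) : Prop :=
  match c with
  | Assign i e => safe W s e /\ Q (setv s i (eval s e))
  | Write a e => [/\ safe W s a, safe W s e & Q (setm s (eval s a) (eval s e))]
  | Input i => Q (State (set_nth 0 (vars s) i (head 0 (tape s)))
                        (heap s) (behead (tape s)))
  | Seq c1 c2 => wp W c1 (wp W c2 Q) s
  | Repeat i c =>
      exists I : nat -> state -> Prop,
      [/\ I (getv s i) s,
          forall k s', getv s' i = k.+1 -> I k.+1 s' ->
            wp W c (fun s'' => getv s'' i = k.+1 /\ I k (setv s'' i k)) s'
        & forall s', getv s' i = 0 -> I 0 s' -> Q s']
  end.

(** * Compilation *)

(** Memory layout: registers below [nvars] hold the variables, those from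
    [nvars] to [base.-1] are scratch space for expressions, and heap cell [a]
    lives in register [base + a]. *)
Definition nvars := 15.
Definition base := 24.

Fixpoint comp_expr (e : expr) (d : nat) : program :=
  match e with
  | Lit v => [:: Const d v]
  | Var i => [:: Const d 0; Add d i d]
  | Plus e1 e2 => comp_expr e1 d ++ comp_expr e2 d.+1 ++ [:: Add d d d.+1]
  | Minus e1 e2 => comp_expr e1 d ++ comp_expr e2 d.+1 ++ [:: Defs.Sub d d d.+1]
  | Cell e => comp_expr e d ++ [:: Const d.+1 base; Add d d d.+1; Fetch d d]
  end.

Fixpoint fits (e : expr) (d : nat) : bool :=
  match e with
  | Lit _ => d < base
  | Var i => (i < nvars) && (d < base)
  | Plus e1 e2 | Minus e1 e2 => fits e1 d && fits e2 d.+1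
  | Cell e => fits e d && (d.+1 < base)
  end.

(** The test of a loop comes after its body and is reached first, by a jump on
    the constant 1, so that a loop whose counter is 0 does nothing. *)
Fixpoint compile (c : com) (L : nat) : program :=
  match c with
  | Assign i e => comp_expr e nvars ++ [:: Const nvars.+1 0; Add i nvars nvars.+1]
  | Write a e =>
      comp_expr a nvars ++ comp_expr e nvars.+1 ++
      [:: Const nvars.+2 base; Add nvars nvars nvars.+2; Store nvars nvars.+1]
  | Input i => [:: Read i]
  | Seq c1 c2 => let p := compile c1 L in p ++ compile c2 (L + size p)
  | Repeat i c =>
      let body := compile c L.+2 in
      [:: Const nvars 1; Jpos nvars (L.+2 + size body).+2] ++ body ++
      [:: Const nvars 1; Defs.Sub i i nvars; Jpos i L.+2]
  end.

Fixpoint wf (c : com) : bool :=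
  match c with
  | Assign i e => (i < nvars) && fits e nvars
  | Write a e => fits a nvars && fits e nvars.+1
  | Input i => i < nvars
  | Seq c1 c2 => wf c1 && wf c2
  | Repeat i c => (i < nvars) && wf c
  end.

Fixpoint expr_size (e : expr) : nat :=
  match e with
  | Lit _ => 1
  | Var _ => 2
  | Plus e1 e2 | Minus e1 e2 => expr_size e1 + expr_size e2 + 1
  | Cell e => expr_size e + 3
  end.

(** A bound on the number of machine steps that depends on the syntax alone:
    when all values are at most [W], so are the counters of all loops. *)
Fixpoint duration (W : nat) (c : com) : nat :=
  match c with
  | Assign _ e => expr_size e + 2
  | Write a e => expr_size a + expr_size e + 3
  | Input _ => 1
  | Seq c1 c2 => duration W c1 + duration W c2
  | Repeat _ c => 3 + W * (duration W c + 3)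
  end.

Lemma size_comp_expr e d : size (comp_expr e d) = expr_size e.
Proof.
elim: e d => //= [e1 IH1 e2 IH2|e1 IH1 e2 IH2|e IH] d;
  by rewrite ?size_cat ?IH1 ?IH2 ?IH ?addnA.
Qed.

Lemma fits_lt e d : fits e d -> d < base.
Proof.
elim: e d => //= [i|e1 IH1 e2 _|e1 IH1 e2 _|e IH] d /andP[] //;
  by move=> /IH1 || move=> /IH.
Qed.

Definition represents (s : state) (X : nat -> nat) :=
  (forall i, i < nvars -> X i = getv s i) /\
  (forall a, X (base + a) = heap s a).

Definition bounded (W : nat) (s : state) :=
  [/\ forall i, getv s i <= W, forall a, heap s a <= W
    & forall x, x \in tape s -> x <= W].

Lemma safe_le W s e : bounded W s -> safe W s e -> eval s e <= W.
Proof.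
move=> [bv bh _]; elim: e => //= [e1 _ e2 _ [] //|e1 IH1 e2 IH2 [s1 s2]].
exact: leq_trans (leq_subr _ _) (IH1 s1).
Qed.

Lemma represents_upd s X i v :
  represents s X -> nvars <= i < base -> represents s (upd X i v).
Proof.
move=> [rv rh] /andP[le_i lt_i]; split=> [j lt_j|a].
  by rewrite upd_neq ?rv //; lia.
by rewrite upd_neq ?rh //; lia.
Qed.

Lemma represents_scratch s X X' :
  represents s X ->
  (forall y, (y < nvars) || (base <= y) -> X' y = X y) -> represents s X'.
Proof.
move=> [rv rh] eqX; split=> [i lt_i|a].
  by rewrite eqX ?rv ?lt_i.
by rewrite eqX ?rh // leq_addr orbT.
Qed.

(** Scratch registers are used like a stack: an expression compiled for register
    [d] leaves the registers below [d] unchanged, in particular the left operand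
    of a sum while the right one is computed. *)
Lemma exec_expr W P s e d L X tp :
  let U := unit_cost (base + W) in
  bounded W s -> safe W s e -> fits e d -> nvars <= d -> represents s X ->
  code_at P L (comp_expr e d) ->
  exists X', [/\ runs P U (expr_size e) (Config L X tp)
                      (Config (L + expr_size e) X' tp),
                 X' d = eval s e
               & forall y, (y < d) || (base <= y) -> X' y = X y].
Proof.
move=> U bs; have [bv bh _] := bs.
elim: e d L X => [v|i|e1 IH1 e2 IH2|e1 IH1 e2 IH2|e IH] d L X /= sf ft le_d rX.
- move=> [Pc _]; exists (upd X d v); split=> [| |y Hy].
  + apply: runs_at Pc erefl _ _; last by rewrite addn1; apply: runs_refl.
    by apply: bitlen1_cost; lia.
  + exact: upd_eq.
  + by rewrite upd_neq //; lia.
- case/andP: ft => lt_i lt_d [Pc [Pc' _]].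
  have Xi : X i = getv s i by case: rX => ->.
  exists (upd (upd X d 0) d (X i + 0)); split=> [| |y Hy].
  + apply: runs_at Pc erefl _ _; first by apply: bitlen1_cost; lia.
    apply: runs_at Pc' erefl _ _.
      by apply: bitlen2_cost; rewrite ?upd_eq ?upd_neq ?Xi //; have := bv i; lia.
    rewrite upd_eq upd_neq; last by lia.
    by rewrite addn2; apply: runs_refl.
  + by rewrite upd_eq addn0.
  + by rewrite !upd_neq //; lia.
- case/andP: ft => f1 f2; case: sf => s1 s2 s3.
  rewrite !code_at_cat !size_comp_expr => -[P1 [P2 [Pc _]]].
  have [X1 [R1 E1 F1]] := IH1 d L X s1 f1 le_d rX P1.
  have rX1 : represents s X1.
    by apply: represents_scratch rX _ => y Hy; apply: F1; lia.
  have [X2 [R2 E2 F2]] := IH2 d.+1 _ X1 s2 f2 (leqW le_d) rX1 P2.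
  have E1' : X2 d = eval s e1 by rewrite F2 ?ltnSn.
  exists (upd X2 d (X2 d + X2 d.+1)); split=> [| |y Hy].
  + apply: runs_trans (runs_trans R1 R2) _.
    apply: runs_at Pc erefl _ _.
      by apply: bitlen2_cost; rewrite ?E1' ?E2; lia.
    by rewrite !addnA addn1; apply: runs_refl.
  + by rewrite upd_eq E1' E2.
  + by have lt_d := fits_lt f1; rewrite upd_neq ?F2 ?F1 //; lia.
- case/andP: ft => f1 f2; case: sf => s1 s2.
  rewrite !code_at_cat !size_comp_expr => -[P1 [P2 [Pc _]]].
  have [X1 [R1 E1 F1]] := IH1 d L X s1 f1 le_d rX P1.
  have rX1 : represents s X1.
    by apply: represents_scratch rX _ => y Hy; apply: F1; lia.
  have [X2 [R2 E2 F2]] := IH2 d.+1 _ X1 s2 f2 (leqW le_d) rX1 P2.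
  have E1' : X2 d = eval s e1 by rewrite F2 ?ltnSn.
  have l1 := safe_le bs s1; have l2 := safe_le bs s2.
  exists (upd X2 d (X2 d - X2 d.+1)); split=> [| |y Hy].
  + apply: runs_trans (runs_trans R1 R2) _.
    apply: runs_at Pc erefl _ _.
      by apply: bitlen2_cost; rewrite ?E1' ?E2; lia.
    by rewrite !addnA addn1; apply: runs_refl.
  + by rewrite upd_eq E1' E2.
  + by have lt_d := fits_lt f1; rewrite upd_neq ?F2 ?F1 //; lia.
- case/andP: ft => f1 lt_d.
  rewrite !code_at_cat !size_comp_expr /= => -[P1 [Pc1 [Pc2 [Pc3 _]]]].
  have [X1 [R1 E1 F1]] := IH d L X sf f1 le_d rX P1.
  have le_e := safe_le bs sf.
  have Ea : X1 d + base = base + eval s e by rewrite E1 addnC.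
  have Eh : X1 (base + eval s e) = heap s (eval s e).
    by rewrite F1 ?leq_addr ?orbT //; case: rX => _ ->.
  pose X2 := upd X1 d.+1 base.
  have X2d : X2 d = X1 d by rewrite /X2 upd_neq //; lia.
  have X2d1 : X2 d.+1 = base by rewrite /X2 upd_eq.
  pose X3 := upd X2 d (X2 d + X2 d.+1).
  have X3d : X3 d = base + eval s e by rewrite /X3 upd_eq X2d X2d1 Ea.
  have X3e : X3 (X3 d) = heap s (eval s e).
    by rewrite X3d /X3 /X2 !upd_neq ?Eh //; lia.
  exists (upd X3 d (X3 (X3 d))); split=> [| |y Hy].
  + apply: runs_trans R1 _.
    apply: runs_at Pc1 erefl _ _; first by apply: bitlen1_cost; rewrite leq_addr.
    apply: runs_at Pc2 erefl _ _; rewrite -/X2.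
      by apply: bitlen2_cost; rewrite ?X2d ?X2d1 ?E1; lia.
    apply: runs_at Pc3 erefl _ _; rewrite -/X3.
      by apply: bitlen2_cost; rewrite ?X3e ?X3d; have := bh (eval s e); lia.
    by rewrite !addnS addn0; apply: runs_refl.
  + by rewrite upd_eq.
  + by rewrite /X3 /X2 !upd_neq ?F1 //; lia.
Qed.

(** Soundness of [wp] for the compiled code, with the time bound included.  For
    a loop, an inner induction on the value of the counter follows the machine
    from one evaluation of the loop test to the last. *)
Lemma exec_com W P c Q s L X :
  let U := unit_cost (base + W) in
  bounded W s -> wf c -> represents s X -> code_at P L (compile c L) ->
  wp W c Q s ->
  exists X' s',
    [/\ runs P U (duration W c) (Config L X (tape s))
             (Config (L + size (compile c L)) X' (tape s')),
        represents s' X', bounded W s' & Q s'].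
Proof.
move=> U; elim: c Q s L X => [i e|a e|i|c1 IH1 c2 IH2|i c IH] Q s L X bs /=.
- move=> /andP[lt_i ft] rX; rewrite code_at_cat size_comp_expr /=.
  move=> [Pe [Pc [Pc' _]]] [sf Qs].
  have [X1 [R1 E1 F1]] := exec_expr (tape s) bs sf ft (leqnn _) rX Pe.
  have le_e := safe_le bs sf; have [bv bh bt] := bs.
  pose X2 := upd X1 nvars.+1 0.
  have E2 : X2 nvars = eval s e by rewrite /X2 upd_neq.
  exists (upd X2 i (X2 nvars + X2 nvars.+1)), (setv s i (eval s e)).
  have Ev : X2 nvars + X2 nvars.+1 = eval s e by rewrite E2 /X2 upd_eq addn0.
  split=> //.
  + apply: runs_trans R1 _.
    apply: runs_at Pc erefl _ _; first by apply: bitlen1_cost.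
    apply: runs_at Pc' erefl _ _; rewrite -/X2.
      by apply: bitlen2_cost; rewrite ?E2 ?upd_eq //; lia.
    by rewrite size_cat size_comp_expr /= !addnS addn0; apply: runs_refl.
  + have rX2 : represents s X2.
      apply: represents_upd => //; apply: represents_scratch rX _ => y Hy.
      by apply: F1; lia.
    case: rX2 => [rv rh]; split=> [j lt_j|b].
      rewrite /getv /= nth_set_nth /= /upd Ev; case: eqP => // _.
      exact: rv.
    by rewrite upd_neq ?rh //; move: lt_i; rewrite /nvars /base; lia.
  + by split=> //= j; rewrite /getv /= nth_set_nth /=; case: eqP => // _; apply: bv.
- move=> /andP[fa fe] rX; rewrite !code_at_cat !size_comp_expr /=.
  move=> [Pa [Pe [Pc1 [Pc2 [Pc3 _]]]]] [sa se Qs].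
  have le_a := safe_le bs sa; have le_e := safe_le bs se; have [bv bh bt] := bs.
  have [X1 [R1 E1 F1]] := exec_expr (tape s) bs sa fa (leqnn _) rX Pa.
  have rX1 : represents s X1.
    by apply: represents_scratch rX _ => y Hy; apply: F1; lia.
  have [X2 [R2 E2 F2]] := exec_expr (tape s) bs se fe (leqnSn _) rX1 Pe.
  have rX2 : represents s X2.
    by apply: represents_scratch rX1 _ => y Hy; apply: F2; lia.
  have E1' : X2 nvars = eval s a by rewrite F2 ?ltnSn.
  pose X3 := upd X2 nvars.+2 base.
  pose X4 := upd X3 nvars (X3 nvars + X3 nvars.+2).
  have X3n : X3 nvars = eval s a by rewrite /X3 upd_neq.
  have X3n2 : X3 nvars.+2 = base by rewrite /X3 upd_eq.
  have X4n : X4 nvars = base + eval s a by rewrite /X4 upd_eq X3n X3n2 addnC.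
  have X4n1 : X4 nvars.+1 = eval s e by rewrite /X4 /X3 !upd_neq.
  have rX4 : represents s X4 by do 2!apply: represents_upd => //.
  exists (upd X4 (X4 nvars) (X4 nvars.+1)), (setm s (eval s a) (eval s e)).
  split=> //.
  + rewrite -addnA; apply: runs_trans R1 _; apply: runs_trans R2 _.
    apply: runs_at Pc1 erefl _ _; first by apply: bitlen1_cost; apply: leq_addr.
    apply: runs_at Pc2 erefl _ _; rewrite -/X3.
      by apply: bitlen2_cost; rewrite ?X3n ?X3n2; lia.
    apply: runs_at Pc3 erefl _ _; rewrite -/X4.
      by apply: bitlen2_cost; rewrite ?X4n ?X4n1; lia.
    rewrite !size_cat !size_comp_expr /= !addnA !addnS addn0.
    exact: runs_refl.
  + rewrite X4n X4n1; case: rX4 => rv rh; split=> [j lt_j|b] /=.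
      by rewrite upd_neq ?rv //; move: lt_j; rewrite /nvars /base; lia.
    by rewrite /upd eqn_add2l; case: eqP => // _; apply: rh.
  + by split=> //= b; rewrite /upd; case: eqP.
- move=> lt_i rX [Pc _] Qs; have [bv bh bt] := bs.
  have le_h : head 0 (tape s) <= W.
    by case: (tape s) bt => //= x l; apply; rewrite mem_head.
  exists (upd X i (head 0 (tape s))).
  exists (State (set_nth 0 (vars s) i (head 0 (tape s))) (heap s) (behead (tape s))).
  split=> //.
  + apply: runs_at Pc erefl _ _; first by apply: bitlen1_cost; lia.
    by rewrite addn1; apply: runs_refl.
  + case: rX => rv rh; split=> [j lt_j|b] /=.
      by rewrite /getv /= nth_set_nth /= /upd; case: eqP => // _; apply: rv.
    by rewrite upd_neq ?rh //; move: lt_i; rewrite /nvars /base; lia.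
  + split=> //= [j|x Hx].
      by rewrite /getv /= nth_set_nth /=; case: eqP => // _; apply: bv.
    by apply: bt; apply: mem_behead.
- move=> /andP[w1 w2] rX; rewrite code_at_cat => -[P1 P2] wp1.
  have [X1 [s1 [R1 rX1 bs1 wp2]]] := IH1 _ _ _ _ bs w1 rX P1 wp1.
  have [X2 [s2 [R2 rX2 bs2 Q2]]] := IH2 _ _ _ _ bs1 w2 rX1 P2 wp2.
  exists X2, s2; split=> //; apply: runs_trans R1 _.
  by rewrite size_cat addnA.
- move=> /andP[lt_i wc] rX.
  set body := compile c L.+2.
  rewrite code_at_cat /= => -[P0 [P1 [Pb [P2 [P3 [P4 _]]]]]].
  move=> [I [I0 IS IQ]].
  set test := (L.+2 + size body).+2.
  have run_test k s1 X1 : getv s1 i = k -> I k s1 -> represents s1 X1 ->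
      bounded W s1 -> exists X2 s2,
      [/\ runs P U (k * (duration W c + 3) + 1) (Config test X1 (tape s1))
               (Config test.+1 X2 (tape s2)),
          represents s2 X2, bounded W s2 & getv s2 i = 0 /\ I 0 s2].
    elim: k s1 X1 => [|k IHk] s1 X1 s1i Ik rX1 bs1.
      exists X1, s1; split=> //.
      have X1i : X1 i = 0 by case: rX1 => ->.
      apply: runs_at P4 erefl _ _; first by apply: bitlen1_cost; rewrite X1i.
      by rewrite X1i; apply: runs_refl.
    have X1i : X1 i = k.+1 by case: rX1 => ->.
    have le_k : k.+1 <= W by rewrite -s1i; case: bs1.
    have [X2 [s2 [R2 rX2 bs2 [s2i I2]]]] :=
      IH _ _ _ _ bs1 wc rX1 Pb (IS _ _ s1i Ik).
    pose X3 := upd X2 nvars 1.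
    have rX3 : represents s2 X3 by apply: represents_upd.
    have X3i : X3 i = k.+1 by case: rX3 => ->.
    have X3n : X3 nvars = 1 by rewrite /X3 upd_eq.
    have E4 : X3 i - X3 nvars = k by rewrite X3i X3n subn1.
    have s4i : getv (setv s2 i k) i = k by rewrite /getv /= nth_set_nth /= eqxx.
    have rX4 : represents (setv s2 i k) (upd X3 i (X3 i - X3 nvars)).
      rewrite E4; case: rX3 => rv rh; split=> [j lt_j|b].
        by rewrite /getv /= nth_set_nth /= /upd; case: eqP => // _; apply: rv.
      by rewrite upd_neq ?rh //; move: lt_i; rewrite /nvars /base; lia.
    have bs4 : bounded W (setv s2 i k).
      case: bs2 => bv bh bt; split=> // j.
      rewrite /getv /= nth_set_nth /=; case: eqP => _; [lia | exact: bv].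
    have [X5 [s5 [R5 rX5 bs5 Q5]]] := IHk _ _ s4i I2 rX4 bs4.
    exists X5, s5; split=> //.
    have -> : k.+1 * (duration W c + 3) + 1 =
              (duration W c + (k * (duration W c + 3) + 1).+2).+1.
      by rewrite mulSn; lia.
    apply: runs_at P4 erefl _ _; first by apply: bitlen1_cost; rewrite X1i; lia.
    rewrite X1i /=; apply: runs_trans R2 _.
    apply: runs_at P2 erefl _ _; first by apply: bitlen1_cost; lia.
    apply: runs_at P3 erefl _ _; rewrite -/X3 //.
    by apply: bitlen2_cost; rewrite ?X3i ?X3n; lia.
  pose X1 := upd X nvars 1.
  have rX1 : represents s X1 by apply: represents_upd.
  have [X2 [s2 [R2 rX2 bs2 [s2i I2]]]] := run_test _ _ _ erefl I0 rX1 bs.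
  exists X2, s2; split=> //; last exact: IQ.
  have le_k : getv s i <= W by case: bs.
  have -> : L + (size (body ++ [:: Const nvars 1; Defs.Sub i i nvars; Jpos i L.+2])).+2
            = test.+1 by rewrite size_cat /test /=; lia.
  apply: (@runs_le _ _ (getv s i * (duration W c + 3) + 1).+2).
    by have := leq_mul2r (duration W c + 3) (getv s i) W; lia.
  apply: runs_at P0 erefl _ _; first by apply: bitlen1_cost; rewrite /base; lia.
  apply: runs_at P1 erefl _ _; rewrite -/X1.
    by rewrite /= /X1 upd_eq; apply: bitlen1_cost; rewrite /base; lia.
  have -> : 0 < X1 nvars by rewrite /X1 upd_eq.
  exact: R2.
Qed.

Definition decider (c : com) (i : nat) : program :=
  let p := compile c 0 in
  p ++ [:: Jpos i (size p).+2; Halt false; Halt true].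

Lemma decider_halts W c i (input : seq nat) (b : bool) :
  wf c -> i < nvars -> (forall x, x \in input -> x <= W) ->
  wp W c (fun s => getv s i = b) (State (nseq nvars 0) (fun=> 0) input) ->
  exists2 t, halts (decider c i) (init input) t b &
             t <= (duration W c).+1 * unit_cost (base + W) + 1.
Proof.
move=> wc lt_i bt wpc; set P := decider c i.
have bs : bounded W (State (nseq nvars 0) (fun=> 0) input).
  by split=> // j; rewrite /getv nth_nseq if_same.
have rX : represents (State (nseq nvars 0) (fun=> 0) input) (fun=> 0).
  by split=> // j _; rewrite /getv nth_nseq if_same.
have [Pc Pend] : code_at P 0 (compile c 0) /\
    code_at P (0 + size (compile c 0))
      [:: Jpos i (size (compile c 0)).+2; Halt false; Halt true].
  by rewrite -code_at_cat; apply: (code_at_suffix [::]).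
have [X [s [R rX' bs' si]]] := exec_com bs wc rX Pc wpc.
move: Pend R; rewrite add0n /= => -[P0 [P1 [P2 _]]] R.
have Xi : X i = b by case: rX' => ->.
set L := size (compile c 0) in P0 P1 P2 R.
have R1 : runs P (unit_cost (base + W)) 1 (Config L X (tape s))
            (Config (if b then L.+2 else L.+1) X (tape s)).
  apply: (runs_at P0) (runs_refl _ _ _ _); first by rewrite /= Xi; case: (b).
  by apply: bitlen1_cost; rewrite Xi /base; case: (b); lia.
have Pb : onth P (if b then L.+2 else L.+1) = Some (Halt b) by case: (b).
have [t Ht le_t] := runs_halts (runs_trans R R1) Pb.
by exists t; rewrite -1?[_.+1]addn1.
Qed.

(** * The dynamic program *)

(* n items, totals S and T, chip weight K = S * T, radix Q, table size N = Q ^ m,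
   target code G, address B of the current table, amount V by which codes are
   moved; the others are counters and temporaries. *)
Local Notation vn := 0 (only parsing).
Local Notation vS := 1 (only parsing).
Local Notation vT := 2 (only parsing).
Local Notation vK := 3 (only parsing).
Local Notation vQ := 4 (only parsing).
Local Notation vN := 5 (only parsing).
Local Notation vG := 6 (only parsing).
Local Notation vB := 7 (only parsing).
Local Notation vV := 8 (only parsing).
Local Notation vy := 9 (only parsing).
Local Notation vz := 10 (only parsing).
Local Notation vi := 11 (only parsing).
Local Notation vj := 12 (only parsing).
Local Notation vx := 13 (only parsing).
Local Notation vl := 14 (only parsing).

Local Coercion Var : nat >-> expr.
Local Notation "e [+] f" := (Plus e f) (at level 50, left associativity).
Local Notation "e [-] f" := (Minus e f) (at level 50, left associativity).
Local Notation "i ::= e" := (Assign i e) (at level 60).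
Local Notation "c ;; d" := (Seq c d) (at level 65, right associativity).

Definition move (add : bool) (x v : nat) := if add then x + v else x - v.
Definition emove (add : bool) := if add then Plus else Minus.

Lemma eval_emove add s e f :
  eval s (emove add e f) = move add (eval s e) (eval s f).
Proof. by case: add. Qed.

Lemma move_le add x v : move add x v <= x + v.
Proof. by case: add => //=; apply: leq_trans (leq_subr _ _) (leq_addr _ _). Qed.

Lemma safe_emove W add s e f :
  safe W s e -> safe W s f -> eval s e + eval s f <= W ->
  safe W s (emove add e f).
Proof. by case: add. Qed.

(** A table is a block of [N] cells holding 0 or 1, followed by the next table.
    For each marked code of the table at [B], the code moved by [V] is marked in
    the table at [B + N].  There is no branching: each cell [d] is replaced by
    [d] or the mark, and [1 - (1 - t)] is the truncation of [t] to 0 or 1.  Fresh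
    tables make the direction of the moves and the order of the scan
    irrelevant, and need no clearing because the memory starts at 0. *)
Definition pass (add : bool) : com :=
  let dst := vB [+] vN [+] emove add (vx [-] Lit 1) vV in
  vx ::= vN ;;
  Repeat vx
    (Write dst
       (Lit 1 [-] (Lit 1 [-] (Cell dst [+] Cell (vB [+] (vx [-] Lit 1)))))).

(** The [m] passes use the amounts [V * Q ^ j], for the [m] parts [j] that can
    receive an item or give back a chip. *)
Definition layer (m : nat) (add : bool) : com :=
  vj ::= Lit m ;;
  Repeat vj
    (pass add ;;
     vy ::= Lit 0 ;;
     vl ::= vQ ;;
     Repeat vl (vy ::= vy [+] vV) ;;
     vV ::= vy) ;;
  vB ::= vB [+] vN.

Definition read_items : com :=
  Input vn ;;
  vi ::= vn [+] vn ;;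
  Repeat vi (Input vx ;; Write (vn [+] vn [-] vi) vx).

Definition sum_items : com :=
  vi ::= vn ;;
  Repeat vi
    (vS ::= vS [+] Cell (vn [-] vi) ;;
     vT ::= vT [+] Cell (vn [+] (vn [-] vi))).

(** The loop on the powers of [Q] computes the target code, whose [m] digits all
    equal [K], by the Horner scheme. *)
Definition set_constants (m : nat) : com :=
  vi ::= vT ;;
  Repeat vi (vK ::= vK [+] vS) ;;
  vQ ::= Lit 1 ;;
  vi ::= vn ;;
  Repeat vi (vQ ::= vQ [+] (vK [+] vK)) ;;
  vN ::= Lit 1 ;;
  vi ::= Lit m ;;
  Repeat vi
    (vy ::= Lit 0 ;;
     vz ::= vK ;;
     vl ::= vQ ;;
     Repeat vl (vy ::= vy [+] vN ;; vz ::= vz [+] vG) ;;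
     vN ::= vy ;;
     vG ::= vz).

(** The machine has no multiplication: repeated additions build the weight
    [T * a_t + S * (T - b_t)] of item [t]. *)
Definition place_items (m : nat) : com :=
  vB ::= vn [+] vn ;;
  Write vB (Lit 1) ;;
  vi ::= vn ;;
  Repeat vi
    (vV ::= Lit 0 ;;
     vl ::= vT ;;
     Repeat vl (vV ::= vV [+] Cell (vn [-] vi)) ;;
     vl ::= vS ;;
     Repeat vl (vV ::= vV [+] (vT [-] Cell (vn [+] (vn [-] vi)))) ;;
     layer m true).

Definition remove_chips (m : nat) : com :=
  vi ::= vn [-] Lit m ;;
  Repeat vi (vV ::= vK ;; layer m false).

Definition fp_solver (m : nat) : com :=
  read_items ;; sum_items ;; set_constants m ;; place_items m ;;
  remove_chips m ;; vx ::= Cell (vB [+] vG).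

(** * Correctness of the dynamic program *)

Lemma wp_seq W c1 c2 Q s : wp W (c1 ;; c2) Q s = wp W c1 (wp W c2 Q) s.
Proof. by []. Qed.

Lemma wp_input W i Q s :
  wp W (Input i) Q s = Q (State (set_nth 0 (vars s) i (head 0 (tape s)))
                                (heap s) (behead (tape s))).
Proof. by []. Qed.

Lemma wp_assign W i e Q s :
  wp W (i ::= e) Q s = (safe W s e /\ Q (setv s i (eval s e))).
Proof. by []. Qed.

Lemma wp_repeat W i c (I : nat -> state -> Prop) Q s :
  I (getv s i) s ->
  (forall k s', getv s' i = k.+1 -> I k.+1 s' ->
     wp W c (fun s'' => getv s'' i = k.+1 /\ I k (setv s'' i k)) s') ->
  (forall s', getv s' i = 0 -> I 0 s' -> Q s') ->
  wp W (Repeat i c) Q s.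
Proof. by move=> I0 IS IQ; exists I. Qed.

(** A cell beyond the first [N] is described as a cell of the next table.  An
    unmarked code may well be moved outside of that table, but this only writes
    back the value that the cell has. *)
Lemma wp_pass {add W n S T K Q N G B V y z i j x l} {h : nat -> nat} {tp}
    {R D : seq nat} {Post} :
  2 <= W -> B + N + N + V <= W -> (forall r, r \in R -> r < N) ->
  (forall r, h (B + r) = (if r < N then r \in R else r - N \in D)) ->
  (forall h' : nat -> nat, (forall a, a < B -> h' a = h a) ->
     (forall r, h' (B + r) =
        (if r < N then r \in R
         else r - N \in D ++ [seq move add r V | r <- R])) ->
     Post (State [:: n; S; T; K; Q; N; G; B; V; y; z; i; j; 0; l] h' tp)) ->
  wp W (pass add) Post
    (State [:: n; S; T; K; Q; N; G; B; V; y; z; i; j; x; l] h tp).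
Proof.
move=> le2 leW ltR hB HPost; split=> //=.
exists (fun k s => k <= N /\ exists h' : nat -> nat, [/\
  s = State [:: n; S; T; K; Q; N; G; B; V; y; z; i; j; k; l] h' tp,
  forall a, a < B -> h' a = h a &
  forall r, h' (B + r) =
    (if r < N then r \in R
     else r - N \in D ++ [seq move add r V | r <- R & k <= r])]).
split.
- rewrite /getv /setv /=; split=> //; exists h; split=> // r; rewrite hB.
  case: ltnP => // _; rewrite mem_cat.
  rewrite (_ : [seq r <- R | N <= r] = [::]) ?orbF //.
  apply/eqP; rewrite -[_ == _]negbK -has_filter; apply/hasPn => r0 /ltR.
  by rewrite ltnNge.
- move=> k _ _ [lt_k [h' [-> lowh' hB']]] /=.
  rewrite !eval_emove /= /setm /setv /getv /= subSS subn0.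
  have le_mv := move_le add k V.
  have Bk : h' (B + k) = (k \in R) by rewrite hB' lt_k.
  set D1 := D ++ [seq move add r V | r <- R & k < r] in hB'.
  have Bd : h' (B + N + move add k V) = (move add k V \in D1).
    by rewrite -addnA hB' ltnNge leq_addr /= addKn.
  have sm : safe W (State [:: n; S; T; K; Q; N; G; B; V; y; z; i; j; k.+1; l] h' tp)
       (emove add (vx [-] Lit 1) vV).
    by apply: safe_emove; rewrite /= /getv /=; lia.
  have le_d : B + N + move add k V <= W by lia.
  rewrite Bk Bd; split; [by split=> //; split; lia | | split=> //].
    do !split=> //; try lia.
  split; first by lia.
  exists (upd h' (B + N + move add k V)
              (1 - (1 - ((move add k V \in D1) + (k \in R))))).
  split=> // [a lt_a|r]; first by rewrite upd_neq ?lowh' //; lia.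
  have memD t : (t \in D ++ [seq move add r V | r <- R & k <= r]) =
      (t \in D1) || (k \in R) && (t == move add k V).
    rewrite /D1 !mem_cat -orbA; congr orb.
    apply/mapP/orP => [[r1]|[/mapP[r1]|/andP[kR /eqP ->]]].
    + rewrite mem_filter => /andP[]; rewrite leq_eqVlt => /predU1P[<-|lt_r1] r1R ->.
        by right; rewrite r1R eqxx.
      by left; apply/mapP; exists r1; rewrite // mem_filter lt_r1.
    + rewrite mem_filter => /andP[lt_r1 r1R] ->; exists r1 => //.
      by rewrite mem_filter r1R ltnW.
    + by exists k; rewrite // mem_filter leqnn.
  rewrite memD /upd -addnA eqn_add2l; case: eqP => [->|ne_r].
    rewrite ltnNge leq_addr /= addKn eqxx andbT.
    by case: (_ \in D1); case: (_ \in R).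
  rewrite hB'; case: ltnP => // le_r.
  case: eqP => [eq_r|_]; last by rewrite andbF orbF.
  by case: ne_r; rewrite -eq_r subnKC.
- move=> s' _ [_ [h' [-> lowh' hB']]]; apply: HPost => // r.
  by rewrite hB' (eq_filter (a2 := predT)) ?filter_predT.
Qed.

(** The codes marked in the table that follows a table with the marks [R]. *)
Definition successors (m : nat) (add : bool) (Q V : nat) (R : seq nat) :=
  [seq move add r (V * Q ^ t) | t <- iota 0 m, r <- R].

Lemma successorsS m add Q V R :
  successors m.+1 add Q V R =
  successors m add Q V R ++ [seq move add r (V * Q ^ m) | r <- R].
Proof.
by rewrite /successors -addn1 iotaD allpairs_cat add0n /= cats0.
Qed.

Lemma wp_scale {W n S T K Q N G B V y z i j x l h tp Post} :
  V * Q <= W ->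
  Post (State [:: n; S; T; K; Q; N; G; B; V * Q; V * Q; z; i; j; x; 0] h tp) ->
  wp W (vy ::= Lit 0 ;; vl ::= vQ ;; Repeat vl (vy ::= vy [+] vV) ;; vV ::= vy)
    Post (State [:: n; S; T; K; Q; N; G; B; V; y; z; i; j; x; l] h tp).
Proof.
move=> leW HPost; do 2!split=> //=.
exists (fun k s => k <= Q /\
  s = State [:: n; S; T; K; Q; N; G; B; V; V * (Q - k); z; i; j; x; k] h tp).
split.
- by rewrite /getv /setv /= subnn muln0.
- move=> k s' _ [lt_k ->]; rewrite /getv /setv /=.
  have -> : V * (Q - k.+1) + V = V * (Q - k) by rewrite addnC -mulnS subnSK.
  split; last by split=> //; split=> //; apply: ltnW.
  by split=> //; apply: leq_trans leW; rewrite leq_mul2l leq_subr orbT.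
- by move=> s' _ [_ ->]; rewrite /getv /setv /= subn0.
Qed.

Lemma wp_layer {m add W n S T K Q N G B V y z i j x l} {h : nat -> nat} {tp}
    {R : seq nat} {Post} :
  2 <= W -> m <= W -> 0 < Q -> B + N + N + V * Q ^ m <= W ->
  (forall r, r \in R -> r < N) ->
  (forall r, h (B + r) = (r \in R)) ->
  (forall (h' : nat -> nat) V' y' x' l', (forall a, a < B -> h' a = h a) ->
     (forall r, h' (B + N + r) = (r \in successors m add Q V R)) ->
     Post (State [:: n; S; T; K; Q; N; G; B + N; V'; y'; z; i; 0; x'; l'] h' tp)) ->
  wp W (layer m add) Post
    (State [:: n; S; T; K; Q; N; G; B; V; y; z; i; j; x; l] h tp).
Proof.
move=> le2 lem Qgt0 leW ltR hB HPost; rewrite /layer !wp_seq !wp_assign.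
split=> //; rewrite wp_seq.
apply: (wp_repeat (I := fun k s => k <= m /\ exists (h' : nat -> nat) y' x' l', [/\
  s = State [:: n; S; T; K; Q; N; G; B; V * Q ^ (m - k); y'; z; i; k; x'; l'] h' tp,
  forall a, a < B -> h' a = h a &
  forall r, h' (B + r) =
    (if r < N then r \in R else r - N \in successors (m - k) add Q V R)])).
- rewrite /getv /setv /= subnn; split=> //; exists h, y, x, l.
  split=> // [|r]; first by rewrite muln1.
  by rewrite hB; case: ltnP => // le_r; case: (boolP (r \in R)) => // /ltR; lia.
- move=> k s' _ [lt_k [h' [y' [x' [l' [-> lowh' hB']]]]]].
  have le_exp t : t <= m -> V * Q ^ t <= V * Q ^ m.
    by move=> le_t; rewrite leq_mul2l leq_pexp2l ?orbT.
  have eqV : V * Q ^ (m - k.+1) * Q = V * Q ^ (m - k).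
    by rewrite -mulnA -expnSr subnSK.
  have leV1 := le_exp (m - k.+1) (leq_subr _ _).
  have leV := le_exp (m - k) (leq_subr _ _).
  rewrite wp_seq; apply: (wp_pass le2 _ ltR hB') => [|h2 low2 hB2]; first by lia.
  apply: wp_scale; rewrite eqV; first by lia.
  rewrite /getv /setv /=; split=> //; split; first exact: ltnW.
  exists h2, (V * Q ^ (m - k)), 0, 0; split=> // [a lt_a|r].
    by rewrite low2 ?lowh'.
  by rewrite hB2 -(subnSK lt_k) successorsS.
- move=> s' _ [_ [h' [y' [x' [l' [-> lowh' hB']]]]]].
  rewrite /getv /setv /=; split.
    by split=> //; apply: leq_trans leW; rewrite -!addnA leq_add2l leq_addr.
  apply: HPost => /= // r.
  by rewrite -addnA hB' ltnNge leq_addr /= addKn subn0.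
Qed.

Lemma wp_read_items {W a b Post} :
  let n := size a in
  size b = n -> n + n <= W ->
  (forall (h : nat -> nat) x, (forall r, h r = nth 0 (a ++ b) r) ->
     Post (State [:: n; 0; 0; 0; 0; 0; 0; 0; 0; 0; 0; 0; 0; x; 0] h [::])) ->
  wp W read_items Post (State (nseq nvars 0) (fun=> 0) (n :: a ++ b)).
Proof.
move=> n sz_b leW HPost; rewrite /read_items wp_seq wp_input wp_seq wp_assign.
split=> //.
apply: (wp_repeat (I := fun k s => k <= n + n /\ exists (h : nat -> nat) x, [/\
  s = State [:: n; 0; 0; 0; 0; 0; 0; 0; 0; 0; 0; k; 0; x; 0] h
        (drop (n + n - k) (a ++ b)) &
  forall r, h r = (if r < n + n - k then nth 0 (a ++ b) r else 0)])).
- split=> //; exists (fun=> 0), 0; rewrite /getv /= subnn drop0.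
  by split=> // r.
- move=> k _ _ [lt_k [h [x [-> hE]]]] /=; rewrite /getv /setv /setm /=.
  do !split=> //; first exact: ltnW.
  have le_p : n + n - k = (n + n - k.+1).+1 by rewrite subnSK.
  set p := n + n - k.+1 in hE le_p *.
  exists (upd h p (head 0 (drop p (a ++ b)))), (head 0 (drop p (a ++ b))).
  split=> [|r].
    by rewrite le_p -drop1 drop_drop add1n.
  rewrite /upd hE le_p ltnS -nth0 nth_drop addn0 (leq_eqVlt r).
  by case: eqP => [->|].
- move=> _ _ [_ [h [x [-> hE]]]]; rewrite subn0 drop_oversize; last first.
    by rewrite size_cat sz_b.
  apply: HPost => r; rewrite hE subn0; case: ltnP => // le_r.
  by rewrite nth_default // size_cat sz_b.
Qed.

Lemma wp_sum_items {W n x} {h : nat -> nat} {tp Post} :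
  \sum_(t < n) h t <= W -> \sum_(t < n) h (n + t) <= W -> n + n <= W ->
  Post (State [:: n; \sum_(t < n) h t; \sum_(t < n) h (n + t);
                  0; 0; 0; 0; 0; 0; 0; 0; 0; 0; x; 0] h tp) ->
  wp W sum_items Post
    (State [:: n; 0; 0; 0; 0; 0; 0; 0; 0; 0; 0; 0; 0; x; 0] h tp).
Proof.
move=> leS leT leW HPost; rewrite /sum_items wp_seq wp_assign; split=> //.
apply: (wp_repeat (I := fun k s => k <= n /\
  s = State [:: n; \sum_(t < n - k) h t; \sum_(t < n - k) h (n + t);
                0; 0; 0; 0; 0; 0; 0; 0; k; 0; x; 0] h tp)).
- by split=> //; rewrite /getv /= subnn !big_ord0.
- move=> k _ _ [lt_k ->] /=; rewrite /getv /setv /=.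
  have mono (f : nat -> nat) :
      \sum_(t < n - k.+1) f t + f (n - k.+1) <= \sum_(t < n) f t.
    rewrite -(big_ord_recr _ (fun t => f t)) /= subnSK // -!(big_mkord xpredT f).
    by rewrite [leqRHS](@big_cat_nat _ _ _ (n - k)) ?leq_addr ?leq_subr.
  do !split=> //.
  + exact: leq_trans (mono h) leS.
  + by apply: leq_trans leW; rewrite leq_add2l leq_subr.
  + by apply: leq_trans (mono (fun t => h (n + t))) leT.
  + exact: ltnW.
  + by rewrite -(subnSK lt_k) !big_ord_recr.
- by move=> _ _ [_ ->]; rewrite subn0.
Qed.

(** The code of the situation in which each of the [m] parts has weight [K]. *)
Definition uniform (m Q K : nat) := \sum_(t < m) K * Q ^ t.

Lemma uniformS m Q K : uniform m.+1 Q K = K + Q * uniform m Q K.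
Proof.
rewrite /uniform big_ord_recl muln1 big_distrr /=; congr addn.
by apply: eq_bigr => t _; rewrite expnS mulnCA.
Qed.

Lemma wp_set_constants {m W n S T y x} {h : nat -> nat} {tp Post} :
  let K := S * T in let Q := 1 + n * (K + K) in
  m <= W -> K + K <= W -> Q <= W -> Q ^ m <= W -> uniform m Q K <= W ->
  (forall y z l, Post (State
     [:: n; S; T; K; Q; Q ^ m; uniform m Q K; 0; 0; y; z; 0; 0; x; l] h tp)) ->
  wp W (set_constants m) Post
    (State [:: n; S; T; 0; 0; 0; 0; 0; 0; y; 0; 0; 0; x; 0] h tp).
Proof.
move=> K Q lem leK leQ leN leG HPost; rewrite /set_constants wp_seq wp_assign.
split=> //; rewrite wp_seq.
have Wgt0 : 0 < W by apply: leq_trans leQ.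
apply: (wp_repeat (I := fun k s => k <= T /\
  s = State [:: n; S; T; S * (T - k); 0; 0; 0; 0; 0; y; 0; k; 0; x; 0] h tp)).
- by split=> //; rewrite /getv /= subnn muln0.
- move=> k _ _ [lt_k ->] /=; rewrite /getv /setv /=.
  have -> : S * (T - k.+1) + S = S * (T - k) by rewrite addnC -mulnS subnSK.
  do !split=> //; last exact: ltnW.
  apply: leq_trans (leq_trans (leq_addr K K) leK).
  by rewrite leq_mul2l leq_subr orbT.
move=> _ _ [_ ->]; rewrite subn0 -/K; do 2!(rewrite wp_seq wp_assign; split=> //).
rewrite wp_seq.
apply: (wp_repeat (I := fun k s => k <= n /\
  s = State [:: n; S; T; K; 1 + (n - k) * (K + K); 0; 0; 0; 0; y; 0; k; 0; x; 0]
        h tp)).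
- by split=> //; rewrite /getv /= subnn.
- move=> k _ _ [lt_k ->] /=; rewrite /getv /setv /=.
  have -> : 1 + (n - k.+1) * (K + K) + (K + K) = 1 + (n - k) * (K + K).
    by rewrite -addnA (addnC _ (K + K)) -mulSn subnSK.
  do !split=> //; last exact: ltnW.
  by apply: leq_trans leQ; rewrite leq_add2l leq_mul2r leq_subr orbT.
move=> _ _ [_ ->]; rewrite subn0 -/Q; do 2!(rewrite wp_seq wp_assign; split=> //).
have Qgt0 : 0 < Q by [].
have leN' t : t <= m -> Q ^ t <= W.
  by move=> le_t; apply: leq_trans leN; apply: leq_pexp2l.
have leG' t : t <= m -> uniform t Q K <= W.
  move=> le_t; apply: leq_trans leG; rewrite /uniform.
  rewrite -!(big_mkord xpredT (fun t => K * Q ^ t)).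
  by rewrite [leqRHS](@big_cat_nat _ _ _ t) ?leq_addr.
apply: (wp_repeat (I := fun k s => k <= m /\ exists y z l,
  s = State [:: n; S; T; K; Q; Q ^ (m - k); uniform (m - k) Q K; 0; 0; y; z; k;
                0; x; l] h tp)).
- by split=> //; exists y, 0, 0; rewrite /getv /setv /= subnn /uniform big_ord0.
- move=> k _ _ [lt_k [y' [z [l ->]]]].
  do 3!(rewrite wp_seq wp_assign; split=> //); rewrite wp_seq.
  have leN1 := leN' (m - k) (leq_subr _ _).
  have leG1 := leG' (m - k) (leq_subr _ _).
  rewrite -(subnSK lt_k) expnS uniformS in leN1 leG1.
  set t := m - k.+1 in leN1 leG1 *.
  have le_part p v q : p + q * v <= W -> forall k, p + (q - k) * v <= W.
    by move=> le_p k1; apply: leq_trans le_p; rewrite leq_add2l leq_mul2r leq_subr orbT.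
  apply: (wp_repeat (I := fun k' s => k' <= Q /\
    s = State [:: n; S; T; K; Q; Q ^ t; uniform t Q K; 0; 0;
                  (Q - k') * Q ^ t; K + (Q - k') * uniform t Q K; k.+1;
                  0; x; k'] h tp)).
  + by split=> //; rewrite /getv /= subnn addn0.
  + move=> k' _ _ [lt_k' ->] /=; rewrite /getv /setv /=.
    have E v : (Q - k'.+1) * v + v = (Q - k') * v by rewrite addnC -mulSn subnSK.
    rewrite -addnA !E; do !split=> //; last exact: ltnW.
    * exact: (le_part 0).
    * exact: le_part.
  + move=> _ _ [_ ->]; rewrite /getv /setv /= subn0; do !split=> //; first exact: ltnW.
    exists (Q * Q ^ t), (K + Q * uniform t Q K), 0.
    by rewrite -(subnSK lt_k) expnS uniformS.
- by move=> _ _ [_ [y' [z [l ->]]]]; rewrite subn0.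
Qed.

Fixpoint placed (m Q : nat) (u : nat -> nat) (k : nat) : seq nat :=
  if k is k'.+1 then successors m true Q (u k') (placed m Q u k') else [:: 0].

Lemma wp_place_items {m W n S T N Q G y z x l} {h : nat -> nat} {tp Post} :
  let K := S * T in
  let u t := T * h t + S * (T - h (n + t)) in
  2 <= W -> m <= W -> 0 < Q -> n + n + n * N + N + N + (K + K) * Q ^ m <= W ->
  (forall t, t < n -> h t <= S) -> (forall r, h (n + n + r) = 0) ->
  (forall k r, k <= n -> r \in placed m Q u k -> r < N) ->
  (forall (h' : nat -> nat) V y j x l,
     (forall r, h' (n + n + n * N + r) = (r \in placed m Q u n)) ->
     Post (State [:: n; S; T; K; Q; N; G; n + n + n * N; V; y; z; 0; j; x; l]
                 h' tp)) ->
  wp W (place_items m) Post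
    (State [:: n; S; T; K; Q; N; G; 0; 0; y; z; 0; 0; x; l] h tp).
Proof.
move=> K u le2 lem Qgt0 leW leS h0 ltN HPost.
have leK2 : K + K <= W.
  apply: leq_trans leW; apply: leq_trans (leq_addl _ _).
  by rewrite leq_pmulr // expn_gt0 Qgt0.
have len2 : n + n <= W by apply: leq_trans leW; rewrite -!addnA addnA leq_addr.
rewrite /place_items; rewrite wp_seq wp_assign; split; first by split.
rewrite wp_seq; split=> //; first exact: ltnW le2.
rewrite wp_seq wp_assign; split=> //.
apply: (wp_repeat (I := fun k s => k <= n /\
  exists (h' : nat -> nat) V y j x l, [/\
  s = State [:: n; S; T; K; Q; N; G; n + n + (n - k) * N; V; y; z; k; j; x; l]
            h' tp,
  forall r, r < n + n -> h' r = h r &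
  forall r, h' (n + n + (n - k) * N + r) = (r \in placed m Q u (n - k))])).
- rewrite /getv /setv /setm /=; split=> //.
  exists (upd h (n + n) 1), 0, y, 0, x, l; rewrite subnn mul0n addn0.
  split=> // [r lt_r|r]; first by rewrite upd_neq //; lia.
  rewrite /upd -{2}[n + n]addn0 eqn_add2l h0 mem_seq1.
  by case: eqP.
- move=> k _ _ [lt_k [h' [V [y' [j [x' [l' [-> lowh' hB']]]]]]]].
  set t := n - k.+1 in hB' *.
  have lt_t : t < n by rewrite /t; lia.
  have St : n - k = t.+1 by rewrite subnSK.
  have ht : h' t = h t by rewrite lowh' //; lia.
  have hnt : h' (n + t) = h (n + t) by rewrite lowh' ?ltn_add2l.
  have le1 : T * h t <= K by rewrite /K mulnC leq_mul2r leS ?orbT.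
  have le_u : u t <= K + K.
    by rewrite /u leq_add // leq_mul2l leq_subr orbT.
  have le_x q : q <= u t -> q <= W.
    by move=> le_q; apply: leq_trans le_q (leq_trans le_u leK2).
  do 2!(rewrite wp_seq wp_assign; split; first by rewrite /=; lia).
  rewrite wp_seq.
  apply: (wp_repeat (I := fun k' s => k' <= T /\ s =
    State [:: n; S; T; K; Q; N; G; n + n + t * N; (T - k') * h t; y'; z; k.+1; j;
              x'; k'] h' tp)).
  + by split=> //; rewrite /getv /= subnn.
  + move=> k' _ _ [lt_k' ->] /=; rewrite /getv /setv /= -/t ht.
    have -> : (T - k'.+1) * h t + h t = (T - k') * h t.
      by rewrite addnC -mulSn subnSK.
    do !split=> //; last exact: ltnW.
    apply: le_x; apply: leq_trans (leq_addr _ _).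
    by rewrite leq_mul2r leq_subr orbT.
  move=> _ _ [_ ->]; rewrite subn0.
  rewrite wp_seq wp_assign; split=> //; rewrite wp_seq.
  apply: (wp_repeat (I := fun k' s => k' <= S /\ s =
    State [:: n; S; T; K; Q; N; G; n + n + t * N;
              T * h t + (S - k') * (T - h (n + t)); y'; z; k.+1; j;
              x'; k'] h' tp)).
  + by split=> //; rewrite /getv /setv /= subnn mul0n addn0.
  + move=> k' _ _ [lt_k' ->] /=; rewrite /getv /setv /= -/t hnt.
    have E : T * h t + (S - k'.+1) * (T - h (n + t)) + (T - h (n + t)) =
             T * h t + (S - k') * (T - h (n + t)).
      by rewrite -addnA [_ * _ + (_ - _)]addnC -mulSn subnSK.
    rewrite E; do !split=> //; last exact: ltnW.
      by lia.
    apply: le_x; rewrite leq_add2l.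
    by rewrite leq_mul2r leq_subr orbT.
  move=> _ _ [_ ->]; rewrite subn0 -/(u t).
  have lt_tN : t * N + N <= n * N by rewrite addnC -mulSn leq_mul2r lt_t orbT.
  have le_uQ : u t * Q ^ m <= (K + K) * Q ^ m by rewrite leq_mul2r le_u orbT.
  apply: (wp_layer le2 lem Qgt0 _ _ hB') => [|r|h2 V2 y2 x2 l2 low2 hB2].
  + by lia.
  + by apply: ltN; apply: ltnW.
  rewrite /getv /setv /=; split=> //; split; first exact: ltnW.
  have EB : n + n + t * N + N = n + n + (n - k) * N by rewrite St mulSn; lia.
  exists h2, V2, y2, 0, x2, l2; rewrite -EB; split=> // [r lt_r|r].
    by rewrite low2 ?lowh' //; lia.
  by rewrite hB2 St.
- move=> _ _ [_ [h' [V [y' [j [x' [l' [-> lowh' hB']]]]]]]].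
  by rewrite !subn0 in hB' *; apply: HPost.
Qed.

Lemma iter_removed_lt m Q K N R k :
  (forall r, r \in R -> r < N) ->
  forall r, r \in iter k (successors m false Q K) R -> r < N.
Proof.
move=> ltR; elim: k => //= k IH r /allpairsP[[t r'] /= [_ r'R ->]].
exact: leq_ltn_trans (leq_subr _ _) (IH _ r'R).
Qed.

Lemma wp_remove_chips {m W n S T K N Q G B V y z j x l} {h : nat -> nat}
    {tp} {R : seq nat} {Post} :
  2 <= W -> m <= W -> 0 < Q ->
  B + (n - m) * N + N + N + K * Q ^ m <= W ->
  (forall r, r \in R -> r < N) ->
  (forall r, h (B + r) = (r \in R)) ->
  (forall (h' : nat -> nat) V y j x l,
     (forall r, h' (B + (n - m) * N + r) =
                (r \in iter (n - m) (successors m false Q K) R)) ->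
     Post (State [:: n; S; T; K; Q; N; G; B + (n - m) * N; V; y; z; 0; j; x; l]
                 h' tp)) ->
  wp W (remove_chips m) Post
    (State [:: n; S; T; K; Q; N; G; B; V; y; z; 0; j; x; l] h tp).
Proof.
move=> le2 lem Qgt0 leW ltR hB HPost; rewrite /remove_chips wp_seq wp_assign.
split=> //; set c := n - m in leW HPost *.
apply: (wp_repeat (I := fun k s => k <= c /\
  exists (h' : nat -> nat) V y j x l, 
  s = State [:: n; S; T; K; Q; N; G; B + (c - k) * N; V; y; z; k; j; x; l]
            h' tp /\
  forall r, h' (B + (c - k) * N + r) =
            (r \in iter (c - k) (successors m false Q K) R))).
- split=> //; exists h, V, y, j, x, l; rewrite /getv /setv /= subnn mul0n addn0.
  by split.
- move=> k _ _ [lt_k [h' [V' [y' [j' [x' [l' [-> hB']]]]]]]].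
  rewrite wp_seq wp_assign; split=> //.
  have St : c - k = (c - k.+1).+1 by rewrite subnSK.
  set t := c - k.+1 in hB' St *.
  have lt_tN : t * N + N <= c * N.
    by rewrite addnC -mulSn leq_mul2r -St leq_subr orbT.
  apply: (wp_layer le2 lem Qgt0 _ _ hB') => [|r|h2 V2 y2 x2 l2 low2 hB2].
  + by rewrite /= /getv /=; lia.
  + exact: iter_removed_lt.
  rewrite /getv /setv /=; split=> //; split; first exact: ltnW.
  have EB : B + t * N + N = B + (c - k) * N by rewrite St mulSn; lia.
  by exists h2, V2, y2, 0, x2, l2; rewrite -EB; split=> // r; rewrite hB2 St.
- move=> _ _ [_ [h' [V' [y' [j' [x' [l' [-> hB']]]]]]]].
  by rewrite subn0 in hB' *; apply: HPost.
Qed.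

Lemma wp_fp_solver {m W a b} :
  let n := size a in
  let S := sumn a in
  let T := sumn b in
  let K := S * T in
  let Q := 1 + n * (K + K) in
  let N := Q ^ m in
  let u t := T * nth 0 a t + S * (T - nth 0 b t) in
  size b = n -> 2 <= W -> m <= W -> S <= W -> T <= W -> Q <= W ->
  uniform m Q K < N ->
  n + n + n * N + n * N + N + N + (K + K) * N <= W ->
  (forall k r, k <= n -> r \in placed m Q u k -> r < N) ->
  wp W (fp_solver m)
    (fun s => getv s vx =
       (uniform m Q K \in iter (n - m) (successors m false Q K) (placed m Q u n)))
    (State (nseq nvars 0) (fun=> 0) (n :: a ++ b)).
Proof.
move=> n S T K Q N u sz_b le2 lem leS leT leQ ltG leW ltN.
have Ngt0 : 0 < N by rewrite expn_gt0.
have leNW : N <= W by lia.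
have leKN : K + K <= (K + K) * N by rewrite leq_pmulr.
have le_mN : (n - m) * N <= n * N by rewrite leq_mul2r leq_subr orbT.
rewrite /fp_solver wp_seq.
apply: wp_read_items => // [|h x hE]; first by rewrite -/n; lia.
have ha t : t < n -> h t = nth 0 a t by move=> lt_t; rewrite hE nth_cat lt_t.
have hb t : h (n + t) = nth 0 b t.
  by rewrite hE nth_cat ltnNge leq_addr /= addKn.
have ES : \sum_(t < n) h t = S.
  rewrite /S sumnE (big_nth 0) big_mkord.
  by apply: eq_bigr => t _; apply: ha.
have ET : \sum_(t < n) h (n + t) = T.
  rewrite /T sumnE (big_nth 0) big_mkord sz_b.
  by apply: eq_bigr => t _; apply: hb.
rewrite wp_seq; apply: wp_sum_items; rewrite ?ES ?ET //; first by lia.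
rewrite wp_seq -/n; apply: wp_set_constants => //; rewrite -/K -/Q -/N ?lem //; try lia.
move=> y z l.
pose u' t := T * h t + S * (T - h (n + t)).
have Eu k : k <= n -> placed m Q u' k = placed m Q u k.
  elim: k => //= k IH lt_k; rewrite IH 1?ltnW //.
  by rewrite /u' /u ha ?hb.
rewrite wp_seq; apply: wp_place_items => //; rewrite -/K -/N.
- by lia.
- by move=> t lt_t; rewrite -ES (bigD1 (Ordinal lt_t)) //= leq_addr.
- by move=> r; rewrite -addnA hb nth_default // sz_b leq_addr.
- by move=> k r le_k; rewrite -/u' Eu //; apply: ltN.
move=> h1 V y1 j x1 l1 h1E; rewrite wp_seq.
apply: (wp_remove_chips le2 lem _ _ _ h1E) => //; rewrite -/N.
- by lia.
- by move=> r; rewrite -/u' Eu //; apply: ltN.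
move=> h2 V2 y2 j2 x2 l2 h2E; rewrite wp_assign.
rewrite /getv /setv /= h2E -/u' Eu //; do !split=> //.
by rewrite /getv /=; lia.
Qed.

(** * Reachable codes *)

Lemma mem_successors m add Q V R y :
  reflect (exists j r, [/\ j < m, r \in R & y = move add r (V * Q ^ j)])
          (y \in successors m add Q V R).
Proof.
apply: (iffP allpairsP) => [[[j r] /= []]|[j [r [lt_j rR ->]]]].
  by rewrite mem_iota => /andP[_ lt_j] rR ->; exists j, r.
by exists (j, r); rewrite mem_iota.
Qed.

Lemma mem_placed m Q u k r :
  r \in placed m Q u k <->
  exists f : nat -> nat,
    (forall t, t < k -> f t < m) /\ r = \sum_(t < k) u t * Q ^ f t.
Proof.
elim: k r => [|k IH] r /=.
  rewrite mem_seq1; split=> [/eqP ->|[f [_ ->]]]; last by rewrite big_ord0.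
  by exists id; rewrite big_ord0.
split=> [/mem_successors [j [r' [lt_j /IH [f [ltf ->]] ->]]]|[f [ltf ->]]].
  exists (fun t => if t == k then j else f t); split=> [t|].
    by case: eqP => // ne_t lt_t; apply: ltf; lia.
  rewrite big_ord_recr /= eqxx; congr addn; apply: eq_bigr => t _.
  by rewrite ltn_eqF.
apply/mem_successors; exists (f k), (\sum_(t < k) u t * Q ^ f t).
split; first exact: ltf.
  by apply/IH; exists f; split=> // t lt_t; apply/ltf/leqW.
by rewrite big_ord_recr.
Qed.

(** Truncated subtraction composes like subtraction, since
    [r - p - q = r - (p + q)] holds for truncated differences too; an impossible
    removal gives the code 0. *)
Lemma mem_iter_removed m Q K R c r :
  r \in iter c (successors m false Q K) R <->
  exists (g : nat -> nat) r0,
    [/\ forall t, t < c -> g t < m, r0 \in R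
      & r = r0 - \sum_(t < c) K * Q ^ g t].
Proof.
elim: c r => [|c IH] r /=.
  split=> [rR|[g [r0 [_ r0R ->]]]]; last by rewrite big_ord0 subn0.
  by exists id, r; rewrite big_ord0 subn0.
split=> [/mem_successors [j [r' [lt_j /IH [g [r0 [ltg r0R ->]]] ->]]]|].
  exists (fun t => if t == c then j else g t), r0; split=> // [t|].
    by case: eqP => // ne_t lt_t; apply: ltg; lia.
  rewrite /move -subnDA big_ord_recr /= eqxx; congr (_ - (_ + _)).
  by apply: eq_bigr => t _; rewrite ltn_eqF.
move=> [g [r0 [ltg r0R ->]]]; apply/mem_successors.
exists (g c), (r0 - \sum_(t < c) K * Q ^ g t); split; first exact: ltg.
  by apply/IH; exists g, r0; split=> // t lt_t; apply/ltg/leqW.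
by rewrite big_ord_recr subnDA.
Qed.

(** All the weight put into the last digit is the worst case. *)
Lemma placed_lt m Q u k r v :
  0 < m -> 0 < Q -> (forall t, t < k -> u t <= v) -> k * v < Q ->
  r \in placed m Q u k -> r < Q ^ m.
Proof.
case: m => // m _ Qgt0 leu lt_kv /mem_placed [f [ltf ->]].
apply: (@leq_ltn_trans (\sum_(t < k) v * Q ^ m)).
  apply: leq_sum => t _; rewrite leq_mul ?leu ?leq_pexp2l //.
  by rewrite -ltnS; apply: ltf.
by rewrite sum_nat_const card_ord mulnA expnS ltn_pmul2r ?expn_gt0 ?Qgt0.
Qed.

Lemma uniform_lt m Q K : K < Q -> uniform m Q K < Q ^ m.
Proof.
move=> lt_K; elim: m => [|m IH]; first by rewrite /uniform big_ord0.
rewrite uniformS expnS.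
have : Q * (uniform m Q K).+1 <= Q * Q ^ m by rewrite leq_mul2l IH orbT.
rewrite mulnS; lia.
Qed.

(** * Digits of a code *)

Lemma sum_by_digit m k Q (w f : nat -> nat) :
  (forall t, t < k -> f t < m) ->
  \sum_(t < k) w t * Q ^ f t =
  \sum_(j < m) (\sum_(t < k | f t == j) w t) * Q ^ j.
Proof.
move=> ltf; rewrite [RHS](eq_bigr _ (fun j _ => big_distrl _ _ _)) /=.
rewrite (exchange_big_dep xpredT) //=; apply: eq_bigr => t _.
rewrite (eq_bigl (pred1 (Ordinal (ltf t (ltn_ord t))))) ?big_pred1_eq //.
Qed.

Lemma digits_inj m Q (d e : nat -> nat) :
  (forall j, j < m -> d j < Q) -> (forall j, j < m -> e j < Q) ->
  \sum_(j < m) d j * Q ^ j = \sum_(j < m) e j * Q ^ j ->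
  forall j, j < m -> d j = e j.
Proof.
elim: m d e => // m IH d e ltd lte; rewrite !big_ord_recl /= !muln1.
have shift (f : nat -> nat) : \sum_(j < m) f (bump 0 j) * Q ^ bump 0 j =
    (\sum_(j < m) f j.+1 * Q ^ j) * Q.
  rewrite big_distrl /=; apply: eq_bigr => j _.
  by rewrite /bump leq0n add1n expnSr mulnA.
rewrite !shift => E.
have E0 : d 0 = e 0.
  have := congr1 (modn^~ Q) E.
  by rewrite addnC modnMDl [e 0 + _]addnC modnMDl !modn_small ?ltd ?lte.
have Qgt0 : 0 < Q by apply: leq_ltn_trans (ltd 0 _).
have E1 : \sum_(j < m) d j.+1 * Q ^ j = \sum_(j < m) e j.+1 * Q ^ j.
  by apply/eqP; rewrite -(eqn_pmul2r Qgt0); move: E; rewrite E0 => /addnI ->.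
case=> [|j] lt_j //.
by apply: (IH (fun j => d j.+1) (fun j => e j.+1)) => // i lt_i; auto.
Qed.

(** By induction on [c]: some fiber has a positive prescribed size, and [c] can
    be sent to it. *)
Lemma map_with_fibers m c (e : nat -> nat) :
  \sum_(j < m) e j = c ->
  exists g : nat -> nat, (forall t, t < c -> g t < m) /\
    (forall j, j < m -> \sum_(t < c | g t == j) 1 = e j).
Proof.
elim: c e => [|c IH] e.
  move/eqP; rewrite sum_nat_eq0 => /forallP e0; exists id; split=> // j lt_j.
  by rewrite big_ord0; have /eqP := e0 (Ordinal lt_j).
move=> sum_e.
have : \sum_(j < m) e j != 0 by rewrite sum_e.
rewrite sum_nat_eq0 negb_forall => /existsP [j0]; rewrite implyTb -lt0n => ej0.
pose e' (j : nat) := if j == val j0 then (e j).-1 else e j.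
have sum_e' : \sum_(j < m) e' j = c.
  move: sum_e; rewrite (bigD1 j0) // [in X in _ -> X](bigD1 j0) //= {1}/e' eqxx.
  rewrite [in X in _ -> X](eq_bigr (fun j : 'I_m => e j)) => [|j].
    by rewrite -{1}(prednK ej0) addSn => -[].
  by rewrite /e' -val_eqE => /negbTE ->.
have [g [ltg gE]] := IH _ sum_e'.
exists (fun t => if t == c then val j0 else g t); split=> [t|j lt_j].
  by case: eqP => [_ _|ne_t lt_t]; [exact: ltn_ord | apply: ltg; lia].
rewrite big_mkcond big_ord_recr /= eqxx -big_mkcond.
rewrite (eq_bigl (fun t : 'I_c => g t == j)) => [|t]; last first.
  by rewrite /= (ltn_eqF (ltn_ord t)).
rewrite [X in X + _]gE // /e'; case: (eqVneq j (val j0)) => [->|_].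
  by rewrite addn1 prednK.
by rewrite addn0.
Qed.

(** The target code is positive, so it cannot come from a truncated removal, and
    being reached is an equation between sums.  No digit overflows on either
    side of this equation: the weights of all the items add up to less than [Q],
    and a part gives back at most [n - m] chips.  Hence the equation holds digit
    by digit. *)
Lemma solver_answerE m n Q K u :
  0 < m -> 0 < n -> 0 < K -> (forall t, t < n -> u t <= K + K) ->
  1 + n * (K + K) = Q ->
  (uniform m Q K \in iter (n - m) (successors m false Q K) (placed m Q u n)) <->
  exists f g : nat -> nat,
    [/\ forall t, t < n -> f t < m, forall t, t < n - m -> g t < m
      & forall j, j < m ->
        \sum_(t < n | f t == j) u t = K * (\sum_(t < n - m | g t == j) 1).+1].
Proof.
move=> mgt0 ngt0 Kgt0 leu defQ; set c := n - m.
have sum1_le k (P : pred 'I_k) : \sum_(t < k | P t) 1 <= k.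
  by rewrite sum1_card -[leqRHS]card_ord max_card.
have ltU f j : \sum_(t < n | f t == j) u t < Q.
  apply: (@leq_ltn_trans (\sum_(t < n) (K + K))); last first.
    by rewrite sum_nat_const card_ord -defQ.
  by rewrite big_mkcond /=; apply: leq_sum => t _; case: ifP => // _; apply: leu.
have ltC g j : K * (\sum_(t < c | g t == j) 1).+1 < Q.
  have leC := sum1_le c (fun t => g t == j).
  rewrite -defQ add1n ltnS mulnC leq_mul ?leq_addr //.
  by apply: leq_ltn_trans leC _; rewrite /c; lia.
have chipsE (g : nat -> nat) : (forall t, t < c -> g t < m) ->
    uniform m Q K + \sum_(t < c) K * Q ^ g t =
    \sum_(j < m) K * (\sum_(t < c | g t == j) 1).+1 * Q ^ j.
  move=> ltg; rewrite (sum_by_digit Q (fun=> K) ltg) -big_split /=.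
  apply: eq_bigr => j _; rewrite -mulnDl mulnS; congr ((_ + _) * _).
  by rewrite big_distrr /=; apply: eq_bigr => t _; rewrite muln1.
have uniform_gt0 : 0 < uniform m Q K.
  by rewrite -(prednK mgt0) uniformS addn_gt0 Kgt0.
split=> [/mem_iter_removed [g [r [ltg /mem_placed [f [ltf ->]] E]]]|[f [g [ltf ltg E]]]].
  exists f, g; split=> //; apply: (digits_inj (Q := Q)) => [j _|j _|].
  - exact: ltU.
  - exact: ltC.
  rewrite -chipsE // -sum_by_digit // E subnK //.
  by rewrite E subn_gt0 in uniform_gt0; apply: ltnW.
apply/mem_iter_removed; exists g, (\sum_(t < n) u t * Q ^ f t); split=> //.
  by apply/mem_placed; exists f.
rewrite (sum_by_digit Q u ltf) -[LHS](addnK (\sum_(t < c) K * Q ^ g t)) chipsE //.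
by congr (_ - _); apply: eq_bigr => j _; rewrite E.
Qed.

(** * Weights and ratios of parts *)

(** The weight of an item is [T * a i - S * b i] shifted by [S * T] to make it
    nonnegative; the identity says this for a part, without subtractions. *)
Lemma weight_of_part (I : finType) (J : {set I}) (a b : I -> nat) S T :
  (forall i, b i <= T) ->
  \sum_(i in J) (T * a i + S * (T - b i)) + S * \sum_(i in J) b i =
  T * \sum_(i in J) a i + S * T * #|J|.
Proof.
move=> leb; rewrite big_split /= -!big_distrr /= -addnA -mulnDr -mulnA.
congr (_ + S * _); rewrite -big_split /= (eq_bigr (fun=> T)) => [|i _].
  by rewrite sum_nat_const mulnC.
by rewrite subnK.
Qed.

(** [T * A] and [S * B] both lie in the interval from 1 to [S * T], so that they
    are equal as soon as they are congruent modulo [S * T]. *)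
Lemma weight_multiple A B S T c d :
  0 < S -> 0 < T -> 0 < A <= S -> 0 < B <= T ->
  S * T * d + S * B = T * A + S * T * c -> T * A = S * B.
Proof.
move=> S0 T0 /andP[A0 leA] /andP[B0 leB] E.
have l1 : 0 < T * A <= S * T by rewrite muln_gt0 T0 A0 mulnC leq_mul2r leA orbT.
have l2 : 0 < S * B <= S * T by rewrite muln_gt0 S0 B0 leq_mul2l leB orbT.
set K := S * T in E l1 l2; set X := T * A in E l1 *; set Y := S * B in E l2 *.
have [lt_cd|lt_dc|eq_cd] := ltngtP c d; last by move: E; rewrite eq_cd; lia.
  have : K * c.+1 <= K * d by rewrite leq_mul2l lt_cd orbT.
  by rewrite mulnS; lia.
have : K * d.+1 <= K * c by rewrite leq_mul2l lt_dc orbT.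
by rewrite mulnS; lia.
Qed.

Lemma ratioP (A B S T : nat) : 0 < S -> 0 < T ->
  (A%:R / B%:R = S%:R / T%:R :> rat)%R <-> 0 < B /\ T * A = S * B.
Proof.
move=> S0 T0.
have T0' : (T%:R != 0 :> rat)%R by rewrite Num.Theory.pnatr_eq0 -lt0n.
have S0' : (S%:R != 0 :> rat)%R by rewrite Num.Theory.pnatr_eq0 -lt0n.
case: (posnP B) => [->|B0].
  rewrite GRing.invr0 GRing.mulr0; split=> [/esym/eqP|[//]].
  by rewrite GRing.mulf_eq0 GRing.invr_eq0 (negbTE S0') (negbTE T0').
have B0' : (B%:R != 0 :> rat)%R by rewrite Num.Theory.pnatr_eq0 -lt0n.
have -> : (A%:R / B%:R = S%:R / T%:R :> rat)%R <->
          (A%:R * T%:R = S%:R * B%:R :> rat)%R.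
  by split=> [/eqP|/eqP E]; [rewrite GRing.eqr_div // => /eqP |
                              apply/eqP; rewrite GRing.eqr_div].
rewrite -!GRing.natrM; split=> [/eqP|[_ <-]]; last by rewrite mulnC.
by rewrite Num.Theory.eqr_nat mulnC => /eqP ->.
Qed.

(** Given a partition, part [j] has weight [K * #|J j|]; these cardinals are
    positive and add up to [n], which leaves [#|J j|.-1] chips for part [j] and
    [n - m] chips in all.  Conversely, a part whose weight is a positive multiple
    of [K] is nonempty, and [weight_multiple] applies to it.  If [n < m], there
    are no chips, and neither side can hold because the weights of the items add
    up to [n * K]. *)
Lemma fp_yesE m (x : fp_instance) :
  let n := fp_n x in
  let S := sumn (fp_a x) in
  let T := sumn (fp_b x) in
  let K := S * T in
  let u t := T * nth 0 (fp_a x) t + S * (T - nth 0 (fp_b x) t) in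
  0 < m ->
  fp_yes m x <->
  exists f g : nat -> nat,
    [/\ forall t, t < n -> f t < m, forall t, t < n - m -> g t < m
      & forall j, j < m ->
        \sum_(t < n | f t == j) u t = K * (\sum_(t < n - m | g t == j) 1).+1].
Proof.
case: x => n a b n0 a0 b0 /=.
set S := sumn a; set T := sumn b; set K := S * T => mgt0; rewrite /fp_yes /fp_ratio /=.
pose A (J : {set 'I_n}) := \sum_(i in J) tnth a i.
pose B (J : {set 'I_n}) := \sum_(i in J) tnth b i.
have SE : \sum_i tnth a i = S by rewrite /S sumnE big_tuple.
have TE : \sum_i tnth b i = T by rewrite /T sumnE big_tuple.
have ai i : 0 < tnth a i by have /all_tnthP := a0.
have bi i : 0 < tnth b i by have /all_tnthP := b0.
have le_sum (w : 'I_n -> nat) (J : {set 'I_n}) :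
    \sum_(i in J) w i <= \sum_i w i.
  by rewrite [leqRHS](bigID (mem J)) /= leq_addr.
have gt_sum (w : 'I_n -> nat) (J : {set 'I_n}) :
    (forall i, 0 < w i) -> J != set0 -> 0 < \sum_(i in J) w i.
  by move=> w0 /set0Pn[i iJ]; rewrite (bigD1 i) //= addn_gt0 w0.
have S0 : 0 < S by rewrite -SE (bigD1 (Ordinal n0)) //= addn_gt0 ai.
have T0 : 0 < T by rewrite -TE (bigD1 (Ordinal n0)) //= addn_gt0 bi.
have leb i : tnth b i <= T by rewrite -TE (bigD1 i) //= leq_addr.
have weightE (J : {set 'I_n}) :
    \sum_(i in J) (T * nth 0 a i + S * (T - nth 0 b i)) + S * B J =
    T * A J + K * #|J|.
  rewrite -(weight_of_part J (tnth a) S leb); congr (_ + _).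
  by apply: eq_bigr => i _; rewrite !(tnth_nth 0).
rewrite SE TE; split=> [[J [[disJ covJ] ratJ]]|[f [g [ltf ltg E]]]].
- have /fin_all_exists [F FJ] : forall i : 'I_n, exists j, i \in J j.
    move=> i; have : i \in \bigcup_j J j by rewrite covJ inE.
    by case/bigcupP=> j; exists j.
  have FE i j : (i \in J j) = (F i == j).
    apply/idP/eqP => [iJ|<- //]; apply/eqP/negPn/negP => /disJ.
    by rewrite disjoints_subset => /subsetP/(_ i (FJ i)); rewrite inE iJ.
  pose f t := if insub t is Some i then val (F i) else 0.
  have fE (i : 'I_n) : f i = F i by rewrite /f valK.
  have eqJ (j : 'I_m) : T * A (J j) = S * B (J j) /\ 0 < B (J j).
    by have /ratioP [] := ratJ j.
  have cardJ (j : 'I_m) : 0 < #|J j|.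
    rewrite lt0n cards_eq0; apply/eqP => J0; case: (eqJ j) => _.
    by rewrite /B J0 big_set0.
  (* a part of size c gives back c - 1 chips *)
  pose e j := if insub j is Some j' then #|J j'|.-1 else 0.
  have sum_card : \sum_(j < m) #|J j| = n.
    rewrite -[RHS]card_ord -sum1_card (partition_big F xpredT) //=.
    by apply: eq_bigr => j _; rewrite -sum1_card; apply: eq_bigl => i; rewrite FE.
  have sum_e : \sum_(j < m) e j = n - m.
    have : \sum_(j < m) e j + \sum_(j < m) 1 = n.
      rewrite -big_split /= -sum_card; apply: eq_bigr => j _.
      by rewrite /e valK addn1 prednK.
    by rewrite sum1_card card_ord => <-; rewrite addnK.
  have [g [ltg gE]] := map_with_fibers sum_e.
  exists f, g; split=> // [t lt_t|j lt_j].
    by rewrite (fE (Ordinal lt_t)).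
  rewrite gE //; pose j' := Ordinal lt_j.
  have -> : (e j).+1 = #|J j'| by rewrite /e -[j]/(val j') valK prednK.
  have [eqj _] := eqJ j'; apply/eqP.
  rewrite -(eqn_add2r (S * B (J j'))) -{2}eqj addnC [K * _ + _]addnC addnC.
  rewrite -weightE; apply/eqP; congr (_ + _); apply: eq_bigl => i.
  by rewrite fE FE.
- exists (fun j : 'I_m => [set i : 'I_n | f i == j]).
  split; first split=> [j k ne_jk|].
  + rewrite disjoints_subset; apply/subsetP => i; rewrite !inE => /eqP ->.
    by rewrite -val_eqE in ne_jk.
  + apply/setP => i; rewrite inE; apply/bigcupP.
    by exists (Ordinal (ltf i (ltn_ord i))); rewrite // inE.
  move=> j; rewrite -/(A _) -/(B _); set J := [set i | _].
  have Ej := E j (ltn_ord j).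
  have J0 : J != set0.
    apply/eqP => J0; move: Ej; rewrite big_pred0 => [|i].
      by move/eqP; rewrite eq_sym muln_eq0 orbF muln_eq0 -!leqn0 leqNgt S0 leqNgt T0.
    by have := in_set0 i; rewrite -J0 inE.
  apply/ratioP => //; have B0 : 0 < B J by apply: gt_sum.
  split=> //; have := weightE J.
  rewrite (eq_bigl (fun i : 'I_n => f i == j)) => [|i]; last by rewrite inE.
  rewrite Ej; apply: weight_multiple => //.
    by rewrite gt_sum // -SE le_sum.
  by rewrite B0 -TE le_sum.
Qed.

(** * Running time *)

Definition poly_bounded (F : nat -> nat -> nat) :=
  exists p : {poly {poly nat}}, forall x y, F x y <= p.[x, y]%R.

Lemma poly_bounded_cst c : poly_bounded (fun _ _ => c).
Proof. by exists (c%:P%:P)%R => x y; rewrite !poly.hornerC. Qed.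

Lemma poly_bounded_fst : poly_bounded (fun x _ => x).
Proof. by exists 'X%R => x y; rewrite poly.hornerX poly.hornerC. Qed.

Lemma poly_bounded_snd : poly_bounded (fun _ y => y).
Proof. by exists (('X)%:P)%R => x y; rewrite poly.hornerC poly.hornerX. Qed.

Lemma poly_bounded_add F G :
  poly_bounded F -> poly_bounded G -> poly_bounded (fun x y => F x y + G x y).
Proof.
move=> [p leF] [q leG]; exists (p + q)%R => x y.
by rewrite !poly.hornerD; apply: leq_add.
Qed.

Lemma poly_bounded_succ F :
  poly_bounded F -> poly_bounded (fun x y => (F x y).+1).
Proof. exact: (poly_bounded_add (poly_bounded_cst 1)). Qed.

Lemma poly_bounded_mul F G :
  poly_bounded F -> poly_bounded G -> poly_bounded (fun x y => F x y * G x y).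
Proof.
move=> [p leF] [q leG]; exists (p * q)%R => x y.
by rewrite !poly.hornerM; apply: leq_mul.
Qed.

Lemma poly_bounded_exp F k :
  poly_bounded F -> poly_bounded (fun x y => F x y ^ k).
Proof.
move=> bF; elim: k => [|k IH]; first exact: poly_bounded_cst.
have [p leF] := poly_bounded_mul bF IH.
by exists p => x y; rewrite expnS.
Qed.

Lemma poly_bounded_duration F c :
  poly_bounded F -> poly_bounded (fun x y => duration (F x y) c).
Proof.
move=> bF; elim: c => [i e|a e|i|c1 IH1 c2 IH2|i c IH] /=;
  by do ?[exact: poly_bounded_cst | exact: bF | exact: IH | exact: IH1 | exact: IH2
         | apply: poly_bounded_add | apply: poly_bounded_mul].
Qed.

(** Dominates every number and address computed by the solver: the inputs, the
    constants, the end of the last table, and the largest amount of a move.  A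
    sum is used because bounds on sums follow by linear arithmetic and are
    visibly monotone. *)
Definition value_bound (m n S T : nat) : nat :=
  let K := S * T in
  let Q := 1 + n * (K + K) in
  let N := Q ^ m in
  2 + m + S + T + Q + (n + n + n * N + n * N + N + N + (K + K) * N).

Lemma value_bound_mono m n n' S S' T T' :
  0 < m -> n <= n' -> S <= S' -> T <= T' ->
  value_bound m n S T <= value_bound m n' S' T'.
Proof.
move=> m0 le_n le_S le_T; rewrite /value_bound.
by repeat (exact: leqnn || assumption || apply: leq_add || apply: leq_mul
           || (rewrite leq_exp2r //)).
Qed.

Lemma poly_bounded_value m :
  poly_bounded (fun x y => value_bound m x (x * y) (x * y)).
Proof.
by do ?[exact: poly_bounded_cst | exact: poly_bounded_fst
       | exact: poly_bounded_snd | apply: poly_bounded_exp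
       | apply: poly_bounded_add | apply: poly_bounded_mul].
Qed.

Lemma sumn_le_max (s : seq nat) M :
  (forall v, v \in s -> v <= M) -> sumn s <= size s * M.
Proof.
elim: s => //= v s IH les; rewrite mulSn leq_add ?les ?mem_head //.
by apply: IH => w ws; apply: les; rewrite inE ws orbT.
Qed.

Lemma size_le_bitlen (s : seq nat) : size s <= \sum_(v <- s) bitlen v.
Proof.
elim: s => [|v s IH] /=; first by rewrite big_nil.
by rewrite big_cons -add1n leq_add.
Qed.

Theorem theorem5 (m : nat) (hm : 2 <= m) :
  pseudo_polynomial_time fp_encode fp_largest (fp_yes m).
Proof.
have m0 : 0 < m by apply: ltnW.
pose W x y := value_bound m x (x * y) (x * y).
have bW : poly_bounded W by apply: poly_bounded_value.
have [p leP] : poly_bounded (fun x y =>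
    (duration (W x y) (fp_solver m)).+1 * unit_cost (base + W x y) + 1).
  have bD := poly_bounded_duration (fp_solver m) bW.
  apply: poly_bounded_add (poly_bounded_cst 1).
  apply: poly_bounded_mul (poly_bounded_succ bD) _.
  apply: poly_bounded_mul (poly_bounded_cst 2) _.
  exact: poly_bounded_succ (poly_bounded_add (poly_bounded_cst base) bW).
exists (decider (fp_solver m) vx), p => x.
set len := \sum_(v <- fp_encode x) bitlen v; set M := fp_largest x.
pose n := fp_n x; pose S := sumn (fp_a x); pose T := sumn (fp_b x).
pose K := S * T; pose Q := 1 + n * (K + K); pose N := Q ^ m.
pose u t := T * nth 0 (fp_a x) t + S * (T - nth 0 (fp_b x) t).
have sz_a : size (fp_a x) = n by rewrite size_tuple.
have sz_b : size (fp_b x) = n by rewrite size_tuple.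
have n0 : 0 < n := fp_n_gt0 x.
have le_n : n <= len.
  apply: leq_trans (size_le_bitlen (fp_encode x)).
  by rewrite /= size_cat sz_a -addnS leq_addr.
have le_max v : v \in fp_a x ++ fp_b x -> v <= M.
  by move=> vs; rewrite /M /fp_largest (@leq_bigmax_seq _ _ xpredT id).
have le_S : S <= len * M.
  apply: leq_trans (leq_mul le_n (leqnn M)); rewrite -sz_a.
  by apply: sumn_le_max => v va; apply: le_max; rewrite mem_cat va.
have le_T : T <= len * M.
  apply: leq_trans (leq_mul le_n (leqnn M)); rewrite -sz_b.
  by apply: sumn_le_max => v vb; apply: le_max; rewrite mem_cat vb orbT.
have le_W : value_bound m n S T <= W len M by apply: value_bound_mono.
rewrite /value_bound -/K -/Q -/N in le_W.
have S0 : 0 < S.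
  rewrite /S; move: (fp_a_gt0 x) sz_a n0.
  by case: (tval (fp_a x)) => [_ <- //|v s /= /andP[v0 _] _ _]; rewrite addn_gt0 v0.
have T0 : 0 < T.
  rewrite /T; move: (fp_b_gt0 x) sz_b n0.
  by case: (tval (fp_b x)) => [_ <- //|v s /= /andP[v0 _] _ _]; rewrite addn_gt0 v0.
have K0 : 0 < K by rewrite muln_gt0 S0.
have le_sumn (s : seq nat) t : nth 0 s t <= sumn s.
  elim: s t => [|v s IH] [|t] //=; first exact: leq_addr.
  exact: leq_trans (IH t) (leq_addl _ _).
have le_u t : u t <= K + K.
  apply: leq_add; last by rewrite leq_mul2l leq_subr orbT.
  by rewrite /K mulnC leq_mul2r le_sumn orbT.
set b := uniform m Q K \in iter (n - m) (successors m false Q K) (placed m Q u n).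
have bE : b = true <-> fp_yes m x.
  have -> : fp_yes m x <-> _ := fp_yesE x m0.
  exact: solver_answerE.
have lt_placed k r : k <= n -> r \in placed m Q u k -> r < N.
  move=> le_k; apply: (placed_lt (v := K + K)) => //.
  by rewrite /Q add1n ltnS leq_mul2r le_k orbT.
have lt_G : uniform m Q K < N.
  apply: uniform_lt; rewrite /Q add1n ltnS.
  by apply: leq_trans (leq_addr K K) _; rewrite leq_pmull.
have le_mem (s : seq nat) v : v \in s -> v <= sumn s.
  by move=> vs; rewrite -(nth_index 0 vs) le_sumn.
have [t Ht le_t] : exists2 t,
    halts (decider (fp_solver m) vx) (init (fp_encode x)) t b &
    t <= (duration (W len M) (fp_solver m)).+1 * unit_cost (base + W len M) + 1.
  apply: decider_halts => // [v|].
    rewrite inE mem_cat => /or3P[/eqP->|/le_mem le_v|/le_mem le_v].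
    - by rewrite -/n; lia.
    - by rewrite -/S in le_v; lia.
    - by rewrite -/T in le_v; lia.
  have := @wp_fp_solver m (W len M) (fp_a x) (fp_b x).
  cbv zeta; rewrite sz_a; apply=> //; rewrite -/S -/T -/K -/Q -/N //; lia.
exists t, b; split=> //.
exact: leq_trans le_t (leP len M).
Qed.
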